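(* Let $n\geq 2$, $m,N\geq 1$, and let $A=\{\alpha_1,\ldots,\alpha_m\}$ be a set of numbers $-1<\alpha_1<\ldots<\alpha_m<1$ symmetric about the origin. Suppose there exists an equi-weighted $N$-point $(m-1,m-1)$-design $C^\ast=\{x_1^\ast,\ldots,x_N^\ast\}\subset \mathbb{S}^{n-1}$ with no antipodal pairs and with $x_i^\ast\cdot x_j^\ast\in A$, $1\leq i\neq j\leq N$. Let $f:[0,1]\to \mathbb R$ be a continuous function such that $f^{(k)}\geq 0$ in $(0,1)$ for $k=1,\ldots,m$. Suppose $(C,W)=(x_1,\ldots,x_{2N};w_1,\ldots,w_{2N})$, where $C=\{x_1,\ldots,x_{2N}\}$ consists of $N$ distinct antipodal pairs on $\mathbb{S}^{n-1}$ and $W=(w_1,\ldots,w_{2N})$ is any vector of non-negative numbers that add up to $1$. Then $$E_f(C,W)=\sum_{i,j=1}^{2N}w_iw_jf\left((x_i\cdot x_j)^2\right)\geq E_f(C^\ast,W^\ast)=\frac {1}{N^2}\sum_{i,j=1}^{N}f\left((x_i^\ast\cdot x_j^\ast)^2\right),\qquad( * )$$ where $W^\ast=\left(\frac {1}{N},\ldots,\frac {1}{N}\right)\in \mathbb R^N$. Assume, in addition, that $f^{(k)}>0$ on $(0,1)$ for $k=1,\ldots,m$. Then equality in $( * )$ holds if and only if $(C,W)$ is a weighted $(m-1,m-1)$-design on $\mathbb{S}^{n-1}$, where each antipodal pair in $C$ has a total weight of $\frac {1}{N}$, and dot products between points from distinct antipodal pairs lie in $A$.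
   Context: $\mathbb S^{n-1}$ is the unit sphere in $\mathbb R^n$ and $x\cdot y$ is the standard dot product. $P_k^{(n)}$ is the Gegenbauer polynomial of degree $k$: the polynomial of degree $k$ orthogonal to all polynomials of degree less than $k$ on $[-1,1]$ with weight $(1-t^2)^{(n-3)/2}$, normalized by $P_k^{(n)}(1)=1$. For pairwise distinct points $x_1,\ldots,x_M\in\mathbb S^{n-1}$ and non-negative weights $w_1,\ldots,w_M$ with sum $1$, write $(C,W)=(x_1,\ldots,x_M;w_1,\ldots,w_M)$, $C=\{x_1,\ldots,x_M\}$, $W=(w_1,\ldots,w_M)$. $(C,W)$ is a weighted $(k,k)$-design, $k\ge1$, if $\sum_{i,j=1}^{M}w_iw_jP_{2\ell}^{(n)}(x_i\cdot x_j)=0$ for $\ell=1,\ldots,k$; every such $(C,W)$ is a $(0,0)$-design. An equi-weighted $(k,k)$-design is one with all weights equal to $1/M$. An antipodal pair is a pair $\{x,-x\}$. The $f$-energy is $E_f(C,W):=\sum_{i,j=1}^{M}w_iw_jf\left((x_i\cdot x_j)^2\right)$. Conditions on $f^{(k)}$ on $(0,1)$ include the existence of these derivatives there. *)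

(* Defs.v *)
From HB Require Import structures.
From mathcomp Require Import all_boot all_order all_algebra.
From mathcomp Require Import all_classical all_reals all_analysis.
Set Implicit Arguments.
Unset Strict Implicit.
Unset Printing Implicit Defensive.
Import Order.TTheory GRing.Theory Num.Theory.
Import numFieldNormedType.Exports.
Local Open Scope classical_set_scope.
Local Open Scope ring_scope.

Definition dotp (R : realType) (n : nat) (x y : 'rV[R]_n) : R :=
  \sum_(i < n) x 0 i * y 0 i.

(* The integrand is Lebesgue integrable when [2 <= n].  The value that [powR]
   gives to the weight at [t = -1] and [t = 1] is immaterial (a null set). *)
Definition is_gegenbauer (R : realType) (n k : nat) (p : {poly R}) : Prop :=
  [/\ size p = k.+1,
      p.[1] = 1
    & forall q : {poly R}, (size q <= k)%N ->
        (\int[@lebesgue_measure R]_(t in `[(- 1)%R, 1%R])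
           (p.[t] * q.[t] * (1 - t ^+ 2) `^ ((n%:R - 3) / 2))%R%:E)%E = 0%E].

(* [is_gegenbauer n k] determines a unique polynomial when [2 <= n]; the
   default value [0] of [xget] plays no role. *)
Definition gegenbauer (R : realType) (n k : nat) : {poly R} :=
  xget 0 [set p : {poly R} | is_gegenbauer n k p].

Definition weighted_code (R : realType) (n M : nat)
    (x : 'I_M -> 'rV[R]_n) (w : 'I_M -> R) : Prop :=
  [/\ forall i, dotp (x i) (x i) = 1,
      injective x,
      forall i, 0 <= w i
    & \sum_(i < M) w i = 1].

Definition weighted_design (R : realType) (n M k : nat)
    (x : 'I_M -> 'rV[R]_n) (w : 'I_M -> R) : Prop :=
  weighted_code x w /\
  forall l : nat, (1 <= l <= k)%N ->
    \sum_(i < M) \sum_(j < M)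
      w i * w j * (gegenbauer R n (2 * l)).[dotp (x i) (x j)] = 0.

Definition energy (R : realType) (n M : nat) (f : R -> R)
    (x : 'I_M -> 'rV[R]_n) (w : 'I_M -> R) : R :=
  \sum_(i < M) \sum_(j < M) w i * w j * f (dotp (x i) (x j) ^+ 2).

(* For an injective family of [2 * N] unit vectors this says that the family
   consists of [N] distinct antipodal pairs. *)
Definition antipodal (R : realType) (n M : nat) (x : 'I_M -> 'rV[R]_n) : Prop :=
  forall i, exists j, x j = - x i.

Definition no_antipodal_pair (R : realType) (n M : nat)
    (x : 'I_M -> 'rV[R]_n) : Prop :=
  forall i j, x j <> - x i.

(* Points of the open interval ]0, 1[ are interior, so [derive1n k f] on it does
   not depend on the values of [f] outside [0, 1]. *)
Definition derivable_upto (R : realType) (m : nat) (f : R -> R) : Prop :=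
  forall k : nat, (k < m)%N ->
    forall t : R, 0 < t < 1 -> derivable (derive1n k f) t 1.

(* Main.v *)
Require Import Defs.
From HB Require Import structures.
From mathcomp Require Import all_boot all_order all_algebra.
From mathcomp Require Import all_classical all_reals all_analysis.
From mathcomp Require Import measurable_realfun.
From mathcomp Require Import ring lra zify.
From mathcomp Require mpoly.
Import (canonicals, coercions) mpoly.
Set Implicit Arguments.
Unset Strict Implicit.
Unset Printing Implicit Defensive.
Import Order.TTheory GRing.Theory Num.Theory.
Import numFieldNormedType.Exports.
Local Open Scope classical_set_scope.
Local Open Scope ring_scope.

(** Write [u = (x . y) ^ 2], so that the energy of a code is a double sum of
[f] over the numbers [u], which lie in [0, 1].  Let [h] be the Hermite
interpolant of [f] at the squares of the elements of [A]: a double node at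
each positive square and, when [0] belongs to [A], a simple node at [0].
These are [m] conditions, so [h] has degree less than [m], and
[f u - h u = f^(m)(xi) / m! * g u] with [g] the nodal polynomial, which is
nonnegative on [0, 1] ([hermite_remainder]).  The energy of [f] is the energy
of [h] plus that of [f - h], and both are minimal at the given design.

For [f - h]: off the diagonal the design only meets zeros of [f - h], so its
energy is [(f - h) 1 / N].  A code made of [N] antipodal pairs has at least
the contribution of its pairs, [(f - h) 1] times the sum of the squared pair
weights, hence at least as much ([antipodal_energy]).

For [h]: as polynomials in [x . y], the powers of [u] up to [u ^ (m - 1)] have
degree at most [2 m - 2], so the energy of the design is the mean of [h] over
the sphere ([design_energy]).  In Newton form [h] is a combination of nodal
polynomials of initial segments of the nodes, with coefficients
[f^(i)(xi) / i!], nonnegative for [i >= 1] ([newton_hermite]).  It is thus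
enough that each of these nodal polynomials [g_i] has energy at least its
mean, for every weighted code.  This holds as soon as [g_i ((x . y) ^ 2)] is a
positive semidefinite kernel on the sphere: apply semidefiniteness to the
difference of the code and the design, whose cross term is the mean by the
design property ([gram_energy_ge]).

Positive semidefiniteness is the heart of the matter ([gram_newton]).  With
[e = 1] if [0] is in [A] and [e = 0] otherwise, and [b_1 < b_2 < ...] the
positive squares, [g_i (t ^ 2)] is, for [i >= 1], a product of two factors
[t ^ e * \prod_(k <= j) (t ^ 2 - b_k)], and the Schur product theorem reduces
the claim to one factor.  Being a design with few inner products, the code
[xs] gives a quadrature formula for the Gegenbauer weight times [t ^ (2 e)], with
nodes the [b_k] and [1] ([lobatto_quadrature]).  Its exactness makes the polynomials
[H_k] with [P_(2 k + e) (t) = t ^ e * H_k (t ^ 2)], [P] being the Gegenbauer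
polynomials, orthogonal for a discrete measure on these nodes.  By an argument
of Cohn and Kumar, products over the first [j] nodes of a discrete measure
are nonnegative combinations of its orthogonal polynomials
([nodal_prefix_coef_ge0]).  So the factor above is a nonnegative combination
of Gegenbauer polynomials, which are positive semidefinite kernels by a
theorem of Schoenberg ([gram_gegenbauer]).  The latter is proved with the
Fischer inner product on polynomials in [n] variables, for which the zonal
polynomials built from [P_k] are a reproducing kernel of the harmonic
polynomials; harmonicity amounts to the coefficient recurrence of [P_k],
obtained from its defining orthogonality by integration by parts.

When the derivatives are positive, so are the Newton coefficients and the
remainder away from the nodes.  Equality then forces the energy of every [g_i]
to be its mean, which is the design property because the [g_i] span; it forces
equal pair weights; and it forces every inner product between pairs to be a
node, which is membership in [A]. *)

(** * Orthogonal polynomials of a positive functional *)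

Section OrthogonalPolynomials.
Variable R : realFieldType.
Implicit Types (S : {scalar {poly R}}) (p q r Q : {poly R}).

Lemma functionalZ S a p : S (a *: p) = a * S p.
Proof. exact: linearZ. Qed.

(** Positivity is only asked below a given size because a discrete functional is
degenerate from the number of its nodes on. *)
Definition positive_upto S (n : nat) : Prop :=
  forall q, q != 0 -> (size q <= n)%N -> 0 < S (q * q).

Definition orth_poly S (k : nat) Q : Prop :=
  [/\ size Q = k.+1, 0 < lead_coef Q
    & forall q, (size q <= k)%N -> S (Q * q) = 0].

Lemma positive_uptoW S m n :
  (m <= n)%N -> positive_upto S n -> positive_upto S m.
Proof. by move=> mn Sp q q0 /leq_trans qm; apply: Sp => //; apply: qm. Qed.

Lemma size_sub_leading k p Q : size Q = k.+1 -> (size p <= k.+1)%N ->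
  (size (p - (p`_k / lead_coef Q) *: Q)%R <= k)%N.
Proof.
move=> sQ sp; apply/leq_sizeP => j kj; rewrite coefB coefZ.
have lQ : lead_coef Q = Q`_k by rewrite lead_coefE sQ.
have lQ0 : lead_coef Q != 0 by rewrite lead_coef_eq0 -size_poly_gt0 sQ.
move: kj; rewrite leq_eqVlt => /predU1P[<-|kj].
  by rewrite -lQ divfK // subrr.
by rewrite [p`_j]nth_default ?(leq_trans sp) // [Q`_j]nth_default ?sQ // mulr0 subr0.
Qed.

(** Gram-Schmidt: an orthogonal polynomial of degree [n] is what is left of
[X^n] after projection, and adding its component extends the projection to
the next degree. *)
Lemma orth_poly_projection S n p : positive_upto S n ->
  exists2 r : {poly R}, (size r <= n)%N &
    forall q, (size q <= n)%N -> S ((p - r) * q) = 0.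
Proof.
elim: n p => [|n IHn] p Sp.
  exists 0; first by rewrite size_poly0.
  by move=> q; rewrite leqn0 size_poly_eq0 => /eqP->; rewrite mulr0 linear0.
have Sp' := positive_uptoW (leqnSn n) Sp.
have [r0 sr0 r0P] := IHn 'X^n Sp'.
pose Q := 'X^n - r0.
have sQ : size Q = n.+1.
  by rewrite /Q size_polyDl ?size_polyXn // size_polyN ltnS.
have Q0 : Q != 0 by rewrite -size_poly_gt0 sQ.
have SQ := Sp Q Q0 (eq_leq sQ).
have [r sr rP] := IHn p Sp'.
set c0 := S ((p - r) * Q) / S (Q * Q).
exists (r + c0 *: Q).
  rewrite (leq_trans (size_polyD _ _)) // geq_max (leq_trans sr) //=.
  by rewrite (leq_trans (size_scale_leq _ _)) // sQ.
move=> q sq.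
have E T : S ((p - (r + c0 *: Q)) * T) = S ((p - r) * T) - c0 * S (Q * T).
  by rewrite opprD addrA mulrBl linearB -scalerAl functionalZ.
rewrite -(subrK ((q`_n / lead_coef Q) *: Q) q) mulrDr linearD /= !E.
rewrite rP ?size_sub_leading // r0P ?size_sub_leading // mulr0 subr0 add0r.
rewrite -!scalerAr !functionalZ mulrCA -mulrBr.
by rewrite /c0 divfK ?subrr ?mulr0 // gt_eqF.
Qed.

Lemma orth_poly_exists S k : positive_upto S k -> exists Q, orth_poly S k Q.
Proof.
move=> Sp; have [r sr rP] := orth_poly_projection 'X^k Sp.
have sQ : size ('X^k - r) = k.+1.
  by rewrite size_polyDl ?size_polyXn // size_polyN ltnS.
exists ('X^k - r); split => //.
rewrite lead_coefDl ?lead_coefXn ?ltr01 // size_polyXn size_polyN ltnS //.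
Qed.

Lemma orth_poly_sqr_gt0 S n k Q : positive_upto S n -> (k < n)%N ->
  orth_poly S k Q -> 0 < S (Q * Q).
Proof.
move=> Sp kn [sQ _ _]; apply: Sp; last by rewrite sQ.
by rewrite -size_poly_gt0 sQ.
Qed.

Lemma orth_poly_leading S k Q p : orth_poly S k Q -> (size p <= k.+1)%N ->
  S (Q * p) = p`_k / lead_coef Q * S (Q * Q).
Proof.
move=> [sQ lQ QP] sp; rewrite -{1}(subrK ((p`_k / lead_coef Q) *: Q) p).
rewrite mulrDr linearD /= QP ?add0r ?size_sub_leading //.
by rewrite -scalerAr functionalZ.
Qed.

Lemma orth_poly_span S (Q : nat -> {poly R}) n p q :
  (forall k, (k < n)%N -> size (Q k) = k.+1) ->
  (forall k, (k < n)%N -> S (p * Q k) = 0) ->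
  (size q <= n)%N -> S (p * q) = 0.
Proof.
elim: n q => [|n IHn] q sQ pQ.
  by rewrite leqn0 size_poly_eq0 => /eqP->; rewrite mulr0 linear0.
move=> sq; rewrite -(subrK ((q`_n / lead_coef (Q n)) *: Q n) q).
rewrite mulrDr linearD /= -scalerAr functionalZ pQ // mulr0 addr0.
apply: IHn; [by move=> k kn; apply/sQ/ltnW|by move=> k kn; apply/pQ/ltnW|].
by apply: size_sub_leading => //; apply: sQ.
Qed.

Lemma orth_poly_orthogonal S j k P Q : orth_poly S j P -> orth_poly S k Q ->
  j != k -> S (P * Q) = 0.
Proof.
move=> [sP _ oP] [sQ _ oQ]; rewrite neq_ltn => /orP[jk|kj].
  by rewrite mulrC oQ ?sP.
by rewrite oP ?sQ.
Qed.

Lemma orth_poly_expand S (Q : nat -> {poly R}) n p : positive_upto S n ->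
  (forall k, (k < n)%N -> orth_poly S k (Q k)) -> (size p <= n)%N ->
  p = \sum_(k < n) (S (p * Q k) / S (Q k * Q k)) *: Q k.
Proof.
move=> Sp oQ sp; apply/eqP; rewrite -subr_eq0; apply/contraT => r0.
set s := \sum_(k < n) _ in r0 *.
have ss : (size s <= n)%N.
  apply: (leq_trans (size_sum _ _ _)); apply/bigmax_leqP => k _.
  apply: (leq_trans (size_scale_leq _ _)).
  by have [-> _ _] := oQ _ (ltn_ord k).
have sr : (size (p - s)%R <= n)%N.
  by rewrite (leq_trans (size_polyD _ _)) // size_polyN geq_max sp.
have := Sp _ r0 sr.
rewrite (@orth_poly_span S Q n) ?ltxx //; first by move=> k /oQ[].
move=> k kn; rewrite mulrBl linearB /= mulr_suml linear_sum /=.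
rewrite (bigD1 (Ordinal kn)) //= -scalerAl functionalZ big1 ?addr0 => [|j jk].
  by rewrite divfK ?subrr // gt_eqF // (orth_poly_sqr_gt0 Sp kn (oQ _ kn)).
rewrite -scalerAl functionalZ (orth_poly_orthogonal (oQ _ _) (oQ _ kn)) ?mulr0 //.
Qed.

(** The functional of the measure multiplied by [c - t]. *)
Definition shift_functional (c : R) S : {poly R} -> R :=
  fun q => S ((c%:P - 'X) * q).

Lemma shift_functional_is_scalar c S : scalar (shift_functional c S).
Proof.
by move=> a p q; rewrite /shift_functional mulrDr -scalerAr linearP.
Qed.

HB.instance Definition _ c S := GRing.isLinear.Build R {poly R} R *%R
  (shift_functional c S) (shift_functional_is_scalar c S).

Lemma size_shift c k Q : size Q = k.+1 -> size ((c%:P - 'X) * Q) = k.+2.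
Proof.
move=> sQ; rewrite -opprB mulNr size_polyN size_monicM ?monicXsubC //.
  by rewrite size_XsubC sQ.
by rewrite -size_poly_gt0 sQ.
Qed.

Lemma lead_coef_shift c Q : lead_coef ((c%:P - 'X) * Q) = - lead_coef Q.
Proof.
rewrite -opprB mulNr lead_coefN lead_coefM.
by rewrite (eqP (monicXsubC c)) mul1r.
Qed.

(** A bound [c] of the support enters only through positivity of the shifted
functional.  If [Q'] is the [k]-th orthogonal polynomial of the latter, then
[(c - t) * Q'] is a combination of the orthogonal polynomials of degrees
[k + 1] and [k], with a negative and a positive coefficient, and it vanishes at
[c]; positivity at [c] thus passes from degree [k] to degree [k + 1]. *)
Lemma orth_poly_gt0 S c n k Q : positive_upto S n ->
  positive_upto (shift_functional c S) n.-1 -> (k < n)%N ->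
  orth_poly S k Q -> 0 < Q.[c].
Proof.
move=> Sp S'p; elim: k Q => [|k IHk] Q kn oQ.
  have [sQ lQ _] := oQ; have /size_poly1P[a a0 Qa] : size Q == 1%N by rewrite sQ.
  by rewrite Qa hornerC; move: lQ; rewrite Qa lead_coefC.
have [ O oO] := orth_poly_exists (positive_uptoW (ltnW (ltnW kn)) Sp).
have O_gt0 := IHk O (ltnW kn) oO.
have kn' : (k < n.-1)%N by move: kn; case: (n).
have [Q' oQ'] := orth_poly_exists (positive_uptoW (ltnW kn') S'p).
have [sQ' lQ' Q'P] := oQ'.
have [sO lO OP] := oO.
have [sQ lQ QP] := oQ.
pose T := (c%:P - 'X) * Q'.
have sT : size T = k.+2 by exact: size_shift.
have lT : lead_coef T = - lead_coef Q' by rewrite lead_coef_shift.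
pose a := lead_coef Q' / lead_coef Q.
have a_gt0 : 0 < a by rewrite divr_gt0.
pose b := S (T * O) / S (O * O).
have SO : 0 < S (O * O) by apply: orth_poly_sqr_gt0 Sp _ oO; rewrite ltnW.
have STO : 0 < S (T * O).
  have -> : S (T * O) = shift_functional c S (Q' * O).
    by rewrite /shift_functional mulrA.
  rewrite (orth_poly_leading oQ') ?sO // mulr_gt0 //.
    by rewrite divr_gt0 // -[k]/(k.+1.-1) -sO -lead_coefE.
  exact: orth_poly_sqr_gt0 S'p kn' oQ'.
pose r := T + a *: Q - b *: O.
have sr1 : (size (T + a *: Q)%R <= k.+1)%N.
  have := @size_sub_leading k.+1 T Q sQ (eq_leq sT).
  by rewrite -[T`_k.+1]/(T`_(k.+2.-1)) -sT -lead_coefE lT mulNr scaleNr opprK.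
have sr : (size r <= k.+1)%N.
  rewrite (leq_trans (size_polyD _ _)) // geq_max sr1 size_polyN.
  by rewrite (leq_trans (size_scale_leq _ _)) // sO.
have Sr q : (size q <= k)%N -> S (r * q) = 0.
  move=> sq; rewrite /r mulrBl mulrDl -!scalerAl linearB linearD !functionalZ.
  rewrite QP ?(leq_trans sq) // OP // !mulr0 addr0 subr0 /T -mulrA.
  exact: Q'P.
have SrO : S (r * O) = 0.
  rewrite /r mulrBl mulrDl -!scalerAl linearB linearD !functionalZ.
  by rewrite QP ?sO // mulr0 addr0 /b divfK ?subrr // gt_eqF.
(* [r] is orthogonal to all polynomials of its degree, hence zero. *)
have r0 : r = 0.
  apply/eqP; apply/contraT => r0.
  have := Sp r r0 (leq_trans sr (ltnW kn)).
  rewrite -{2}(subrK ((r`_k / lead_coef O) *: O) r) mulrDr linearD /=.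
  by rewrite Sr ?size_sub_leading // -scalerAr functionalZ SrO mulr0 addr0 ltxx.
have /eqP := congr1 (horner^~ c) r0.
rewrite /r /T !hornerE subrr mul0r add0r subr_eq0 => /eqP e.
by rewrite -(pmulr_rgt0 _ a_gt0) e mulr_gt0 // divr_gt0.
Qed.

(** The coefficients of the expansion of a shifted orthogonal polynomial [Q] in
the original ones.  Since [Q] is orthogonal to all multiples of [c - t] of low
degree, [S (Q * P)] is [P.[c] * S Q] (the Christoffel-Darboux kernel); the
sign of [S Q] follows by taking for [P] the orthogonal polynomial of the
degree of [Q]. *)
Lemma shift_orth_poly_coef_ge0 S c n k l Q P : positive_upto S n ->
  positive_upto (shift_functional c S) n.-1 -> (k < n)%N -> (l < n)%N ->
  orth_poly (shift_functional c S) k Q -> orth_poly S l P ->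
  0 <= S (Q * P).
Proof.
move=> Sp S'p kn ln oQ oP; have [sQ lQ QP] := oQ; have [sP lP PP] := oP.
case: (ltnP k l) => [kl|lk]; first by rewrite mulrC PP ?sQ.
have S_Q (T : {poly R}) : (size T <= k.+1)%N -> S (Q * T) = T.[c] * S Q.
  move=> sT; have /factor_theorem[r rE] : root (T - T.[c]%:P) c.
    by rewrite rootE !hornerE subrr.
  have TE : T = (c%:P - 'X) * (- r) + T.[c]%:P.
    by rewrite -opprB mulrNN mulrC -rE subrK.
  have sr : (size (- r)%R <= k)%N.
    rewrite size_polyN; case: (eqVneq r 0) => [->|r0]; first by rewrite size_poly0.
    have : size (T - T.[c]%:P) = (size r).+1.
      by rewrite rE size_Mmonic ?monicXsubC // size_XsubC addn2.
    move=> e; rewrite -ltnS -e (leq_trans (size_polyD _ _)) // size_polyN.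
    by rewrite geq_max sT (leq_trans (size_polyC_leq1 _)).
  rewrite {1}TE mulrDr linearD /= mulrCA.
  (* The multiple of [c - t] is killed by orthogonality in the shifted measure. *)
  have -> : S ((c%:P - 'X) * (Q * - r)) = 0 := QP _ sr.
  by rewrite add0r mulrC mul_polyC functionalZ.
have [ O oO] := orth_poly_exists (positive_uptoW (ltnW kn) Sp).
have [sO lO OP] := oO.
have SQ : 0 < S Q.
  rewrite -(pmulr_rgt0 _ (orth_poly_gt0 Sp S'p kn oO)) -S_Q ?sO //.
  rewrite mulrC (orth_poly_leading oO) ?sQ // mulr_gt0 //.
    by rewrite divr_gt0 // -[k]/(k.+1.-1) -sQ -lead_coefE.
  exact: orth_poly_sqr_gt0 Sp kn oO.
by rewrite S_Q ?sP // mulr_ge0 // ltW // (orth_poly_gt0 Sp S'p ln oP).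
Qed.

End OrthogonalPolynomials.

Section DiscreteFunctional.
Variable R : realFieldType.
Implicit Types (s : seq R) (w : R -> R) (p q Q : {poly R}).

Definition discrete_functional s w : {poly R} -> R :=
  fun q => \sum_(b <- s) w b * q.[b].

Lemma discrete_functional_is_scalar s w : scalar (discrete_functional s w).
Proof.
move=> a p q; rewrite /discrete_functional mulr_sumr -big_split /=.
by apply: eq_bigr => b _; rewrite hornerD hornerZ mulrDr mulrCA.
Qed.

HB.instance Definition _ s w := GRing.isLinear.Build R {poly R} R *%R
  (discrete_functional s w) (discrete_functional_is_scalar s w).

Lemma discrete_positive s w : uniq s -> (forall b, b \in s -> 0 < w b) ->
  positive_upto (discrete_functional s w) (size s).
Proof.
move=> us ws q q0 sq; have qq_ge0 b : 0 <= (q * q).[b] by rewrite hornerM -expr2 sqr_ge0.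
rewrite /= /discrete_functional lt_neqAle.
apply/andP; split; last first.
  by rewrite big_seq; apply: sumr_ge0 => b bs; rewrite mulr_ge0 ?qq_ge0 // ltW ?ws.
rewrite eq_sym; apply: contraNN q0 => e0.
have : all (root q) s.
  apply/allP => b bs; move: e0; rewrite big_seq psumr_eq0; last first.
    by move=> a /ws/ltW wa; rewrite mulr_ge0 ?qq_ge0.
  move=> /allP/(_ b bs)/implyP/(_ bs); rewrite mulf_eq0 gt_eqF ?ws //=.
  by rewrite hornerM mulf_eq0 orbb.
by apply: contraTT => q0; apply/negP => /(max_poly_roots q0)/(_ us); rewrite ltnNge sq.
Qed.

Lemma shift_discrete s w c :
  shift_functional c (discrete_functional (rcons s c) w) =1
  discrete_functional s (fun b => (c - b) * w b).
Proof.
move=> q; rewrite /shift_functional /= /discrete_functional big_rcons /=.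
rewrite hornerM !hornerD hornerN hornerC hornerX subrr mul0r mulr0 addr0; apply: eq_bigr => b _.
by rewrite hornerM !hornerD hornerN hornerC hornerX mulrCA mulrA.
Qed.

Lemma eq_positive_upto (S S' : {scalar {poly R}}) n : S =1 S' ->
  positive_upto S n -> positive_upto S' n.
Proof. by move=> e Sp q q0 sq; rewrite -e; apply: Sp. Qed.

Lemma eq_orth_poly (S S' : {scalar {poly R}}) k Q : S =1 S' ->
  orth_poly S k Q -> orth_poly S' k Q.
Proof. by move=> e [? ? QP]; split=> // q sq; rewrite -e; apply: QP. Qed.

(** Induction on the number of nodes, removing the largest one, [c].  The product
over all nodes but [c] only sees [c], where orthogonal polynomials are
positive.  A shorter product is, by induction, a nonnegative combination of the
orthogonal polynomials of the measure multiplied by [c - t], in which [c] has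
no mass; these are themselves nonnegative combinations of the orthogonal
polynomials of the original measure. *)
Lemma nodal_prefix_coef_ge0 s w j k Q :
  sorted <%R s -> (forall b, b \in s -> 0 < w b) -> (j < size s)%N ->
  orth_poly (discrete_functional s w) k Q ->
  0 <= discrete_functional s w ((\prod_(b <- take j s) ('X - b%:P)) * Q).
Proof.
elim/last_ind: s w j k Q => // s c IHs w j k Q ss ws js oQ.
have us := sorted_uniq lt_trans ltxx ss.
have := us; rewrite rcons_uniq => /andP[cs us'].
have cmax b : b \in s -> b < c.
  move=> bs; move: ss; rewrite -cats1 sorted_pairwise; last exact: lt_trans.
  rewrite pairwise_cat => /and3P[/allrelP/(_ b c bs)].
  by rewrite mem_seq1 eqxx => ->.
have ss' : sorted <%R s.
  by move: ss; rewrite -cats1 => /cat_sorted2[].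
pose S := discrete_functional (rcons s c) w.
pose w' b := (c - b) * w b.
have w'_gt0 b : b \in s -> 0 < w' b.
  move=> bs; rewrite mulr_gt0 ?subr_gt0 ?cmax // ws //.
  by rewrite mem_rcons inE bs orbT.
have Sp : positive_upto S (size s).+1.
  by have := discrete_positive us ws; rewrite size_rcons.
have S'E := shift_discrete s w c.
have S'p : positive_upto (shift_functional c S) (size s).
  apply: (@eq_positive_upto (discrete_functional s w')); last exact: discrete_positive.
  by move=> q; exact/esym/S'E.
rewrite size_rcons in js.
(* Orthogonality kills the sum when [Q] has degree larger than the product. *)
case: (ltnP k (size s).+1) => [ks|sk]; last first.
  rewrite mulrC; have [_ _ ->] := oQ; rewrite // size_prod_XsubC.
  by rewrite size_takel ?size_rcons ?(leq_trans js) // ltnW.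
have [jlt|jge] := ltnP j (size s); last first.
  have -> : j = size s by apply/eqP; rewrite eqn_leq -ltnS js.
  rewrite -cats1 take_size_cat // cats1 /discrete_functional big_rcons /=.
  rewrite big_seq big1 ?add0r => [|b bs]; last first.
    rewrite hornerM (_ : (\prod_(i <- s) ('X - i%:P)).[b] = 0) ?mul0r ?mulr0 //.
    by apply/eqP; rewrite -/(root _ b) root_prod_XsubC.
  rewrite mulr_ge0 // ?ltW ?ws ?mem_rcons ?inE ?eqxx // hornerM.
  rewrite mulr_gt0 ?(orth_poly_gt0 Sp S'p ks oQ) // horner_prod.
  rewrite big_seq; apply: prodr_gt0 => b bs.
  by rewrite !hornerE subr_gt0 cmax.
rewrite -cats1 takel_cat ?(ltnW jlt) // cats1.
set p := \prod_(b <- _) _.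
have sp : (size p <= size s)%N by rewrite size_prod_XsubC size_takel // ltnW.
have exO l : { O | (l < size s)%N -> orth_poly (shift_functional c S) l O}.
  case: (ltnP l (size s)) => ls; last by exists 0.
  case/cid: (orth_poly_exists (positive_uptoW (ltnW ls) S'p)) => O oO.
  by exists O.
pose O l := sval (exO l).
have oO l : (l < size s)%N -> orth_poly (shift_functional c S) l (O l).
  exact: svalP (exO l).
rewrite (orth_poly_expand S'p oO sp) mulr_suml linear_sum sumr_ge0 // => l _.
rewrite -scalerAl functionalZ mulr_ge0 //; last first.
  exact: (shift_orth_poly_coef_ge0 Sp S'p (ltnW (ltn_ord l)) ks (oO _ _) oQ).
rewrite divr_ge0 //.
  suff h : 0 <= discrete_functional s w' (p * O l) by move: h; rewrite -S'E.
  apply: (IHs w' j l) => //.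
  by apply: (eq_orth_poly _ (oO l (ltn_ord l))) => q; exact: S'E.
exact/ltW/(orth_poly_sqr_gt0 S'p (ltn_ord l) (oO l (ltn_ord l))).
Qed.

End DiscreteFunctional.

(** * Positive semidefinite kernels and the Fischer inner product *)

Section GramKernels.
Variables (R : realType) (n : nat).
Implicit Types K : 'rV[R]_n -> 'rV[R]_n -> R.

(** Positive semidefinite kernels on the unit sphere, given by an explicit finite
feature map: in this form products of kernels are immediate, and one feature
map serves all codes at once. *)
Definition gram_kernel K : Prop :=
  exists (T : finType) (phi : 'rV[R]_n -> T -> R),
    forall x y, dotp x x = 1 -> dotp y y = 1 ->
      K x y = \sum_t phi x t * phi y t.

Lemma eq_gram_kernel K L :
  (forall x y, dotp x x = 1 -> dotp y y = 1 -> K x y = L x y) ->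
  gram_kernel K -> gram_kernel L.
Proof.
by move=> KL [T [phi E]]; exists T, phi => x y x1 y1; rewrite -KL // E.
Qed.

Lemma gram_kernel_rank1 (g : 'rV[R]_n -> R) :
  gram_kernel (fun x y => g x * g y).
Proof. by exists unit, (fun x _ => g x) => x y _ _; rewrite big_const card_unit /= addr0. Qed.

Lemma gram_kernelD K L : gram_kernel K -> gram_kernel L ->
  gram_kernel (fun x y => K x y + L x y).
Proof.
move=> [T [phi E]] [U [psi F]].
exists (T + U)%type, (fun x t => match t with inl t => phi x t | inr u => psi x u end).
by move=> x y x1 y1; rewrite big_sumType /= E ?F.
Qed.

Lemma gram_kernelM K L : gram_kernel K -> gram_kernel L ->
  gram_kernel (fun x y => K x y * L x y).
Proof.
move=> [T [phi E]] [U [psi F]].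
exists (T * U)%type, (fun x t => phi x t.1 * psi x t.2) => x y x1 y1.
rewrite E // F // big_distrlr /= pair_big /=.
by apply: eq_bigr => t _; rewrite mulrACA.
Qed.

Lemma gram_kernelZ a K : 0 <= a -> gram_kernel K ->
  gram_kernel (fun x y => a * K x y).
Proof.
move=> a0; apply: gram_kernelM.
have := gram_kernel_rank1 (fun=> Num.sqrt a).
by apply: eq_gram_kernel => x y _ _; rewrite -expr2 sqr_sqrtr.
Qed.

Lemma gram_kernel_sum (I : Type) (r : seq I) (K : I -> 'rV[R]_n -> 'rV[R]_n -> R) :
  (forall i, gram_kernel (K i)) -> gram_kernel (fun x y => \sum_(i <- r) K i x y).
Proof.
move=> gK; elim: r => [|i r IHr].
  have := gram_kernel_rank1 (fun=> 0).
  by apply: eq_gram_kernel => x y _ _; rewrite big_nil mulr0.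
by apply: eq_gram_kernel (gram_kernelD (gK i) IHr) => x y _ _; rewrite big_cons.
Qed.

End GramKernels.

Section Fischer.
Variables (R : realType) (n : nat).
Local Notation P := (mpoly.mpoly n R).
Local Notation d := (@mpoly.mderiv n R).
Local Notation Xv i := (mpoly.mpolyX R (mpoly.mnm1 i) : P).
Local Notation ev0 := (@mpoly.mcoeff n R mpoly.mnm0).
Implicit Types p q : P.

Lemma mderiv_var i j : d i (Xv j) = (i == j)%:R.
Proof.
rewrite mpoly.mderivX mpoly.mnm1E eq_sym; case: eqVneq => [->|_]; last by rewrite scale0r.
rewrite scale1r (_ : mpoly.mnm_sub _ _ = mpoly.mnm0) ?mpoly.mpolyX0 //.
by apply/mpoly.mnmP => k; rewrite mpoly.mnmBE subnn mpoly.mnm0E.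
Qed.

Lemma mderiv_sum i (I : Type) (s : seq I) (F : I -> P) :
  d i (\sum_(j <- s) F j) = \sum_(j <- s) d i (F j).
Proof. exact: linear_sum. Qed.

Lemma mderiv_exp i p s : d i (p ^+ s) = s%:R *: (p ^+ s.-1 * d i p).
Proof.
elim: s => [|s IHs]; first by rewrite expr0 mpoly.mderivC scale0r.
rewrite exprS mpoly.mderivM IHs -scalerAr mulrA -exprS.
case: s {IHs} => [|s]; first by rewrite scale0r addr0 scale1r expr0 mulrC.
by rewrite -[s.+2%:R]nat1r scalerDl scale1r mulrC.
Qed.

(** [k!] times the Fischer inner product on homogeneous polynomials of degree [k]
(the one for which multiplication by a variable is adjoint to the partial
derivative).  Unfolded, it sums over words of [k] partial derivatives, so it is
manifestly a sum of squares on the diagonal. *)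
Fixpoint fischer k p q : R :=
  if k is k'.+1 then \sum_i fischer k' (d i p) (d i q) else ev0 p * ev0 q.

Lemma fischerC k p q : fischer k p q = fischer k q p.
Proof.
elim: k p q => [|k IHk] p q /=; first exact: mulrC.
by apply: eq_bigr => i _; apply: IHk.
Qed.

Lemma fischerP k q : scalar (fischer k ^~ q).
Proof.
elim: k q => [|k IHk] q a p p' /=.
  by rewrite mpoly.mcoeffD mpoly.mcoeffZ mulrDl mulrA.
rewrite mulr_sumr -big_split /=; apply: eq_bigr => i _.
by rewrite mpoly.mderivD mpoly.mderivZ IHk.
Qed.

Lemma fischerDl k p p' q : fischer k (p + p') q = fischer k p q + fischer k p' q.
Proof. by have := fischerP k q 1 p p'; rewrite scale1r mul1r. Qed.

Lemma fischer0l k q : fischer k 0 q = 0.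
Proof.
by have /eqP := fischerDl k 0 0 q; rewrite addr0 -subr_eq subrr eq_sym => /eqP.
Qed.

Lemma fischerZl k a p q : fischer k (a *: p) q = a * fischer k p q.
Proof. by have := fischerP k q a p 0; rewrite !addr0 fischer0l addr0. Qed.

Lemma fischer_suml k (I : Type) (r : seq I) (F : I -> P) q :
  fischer k (\sum_(i <- r) F i) q = \sum_(i <- r) fischer k (F i) q.
Proof.
elim: r => [|i r IHr]; first by rewrite !big_nil fischer0l.
by rewrite !big_cons fischerDl IHr.
Qed.

Lemma gram_fischer k (Z : 'rV[R]_n -> P) :
  gram_kernel (fun x y => fischer k (Z x) (Z y)).
Proof.
elim: k Z => [|k IHk] Z /=; first exact: (gram_kernel_rank1 (fun x => ev0 (Z x))).
by apply: gram_kernel_sum => i; apply: (IHk (fun x => d i (Z x))).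
Qed.

Lemma ev0X i p : ev0 (Xv i * p) = 0.
Proof.
rewrite (mpoly.mcoeff0_is_multiplicative n R).1 mpoly.mcoeffX.
by rewrite mpoly.mnm1_eq0 mul0r.
Qed.

(** Differentiating [X_i * p] produces [p] once, and otherwise commutes with the
multiplication; the factor [k + 1] counts the positions of [i] in a word. *)
Lemma fischer_mulX k i p q :
  fischer k.+1 (Xv i * p) q = k.+1%:R * fischer k p (d i q).
Proof.
elim: k p q => [|k IHk] p q.
  rewrite /= (bigD1 i) //= big1 ?addr0 => [|j ji]; rewrite mpoly.mderivM mderiv_var.
    by rewrite eqxx !mul1r mpoly.mcoeffD ev0X addr0.
  by rewrite (negPf ji) mul0r add0r ev0X mul0r. 
rewrite [LHS]/=.
have E j : fischer k.+1 (d j (Xv i * p)) (d j q) =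
    (j == i)%:R * fischer k.+1 p (d j q)
    + k.+1%:R * fischer k (d j p) (d j (d i q)).
  rewrite mpoly.mderivM mderiv_var fischerDl IHk (mpoly.mderiv_comm i j).
  by rewrite -scaler_nat -scalerAl mul1r fischerZl.
rewrite (eq_bigr _ (fun j _ => E j)) big_split -mulr_sumr.
rewrite -[in RHS]nat1r mulrDl mul1r; congr (_ + _).
rewrite (bigD1 i) //= eqxx mul1r [X in _ + X]big1 ?addr0 // => j ji.
by rewrite (negPf ji) mul0r.
Qed.

Definition linear_form (y : 'rV[R]_n) : P := \sum_i y 0 i *: Xv i.
Definition sqr_norm : P := \sum_i Xv i * Xv i.
Definition dir_deriv (y : 'rV[R]_n) p : P := \sum_i y 0 i *: d i p.
Definition laplacian p : P := \sum_i d i (d i p).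
Local Notation "''l' y" := (linear_form y) (at level 8, y at level 2).
Local Notation r := sqr_norm.

Lemma fischer_mul_linear_form k y p q :
  fischer k.+1 ('l y * p) q = k.+1%:R * fischer k p (dir_deriv y q).
Proof.
rewrite /linear_form mulr_suml fischer_suml [in RHS]fischerC /dir_deriv.
rewrite fischer_suml mulr_sumr; apply: eq_bigr => i _.
by rewrite -scalerAl !fischerZl fischer_mulX [in RHS]fischerC mulrCA.
Qed.

Lemma fischer_mul_sqr_norm k p q :
  fischer k.+2 (r * p) q = (k.+2 * k.+1)%:R * fischer k p (laplacian q).
Proof.
rewrite /sqr_norm mulr_suml fischer_suml [in RHS]fischerC /laplacian.
rewrite fischer_suml mulr_sumr; apply: eq_bigr => i _.
by rewrite -mulrA !fischer_mulX [in RHS]fischerC natrM mulrA.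
Qed.

Lemma mderiv_linear_form i y : d i ('l y) = y 0 i *: 1.
Proof.
rewrite /linear_form mderiv_sum (bigD1 i) //= big1 ?addr0 => [|j ji].
  by rewrite mpoly.mderivZ mderiv_var eqxx.
by rewrite mpoly.mderivZ mderiv_var eq_sym (negPf ji) scaler0.
Qed.

Lemma mderiv_sqr_norm i : d i r = 2%:R *: Xv i.
Proof.
rewrite /sqr_norm mderiv_sum (bigD1 i) //= big1 ?addr0 => [|j ji].
  by rewrite mpoly.mderivM mderiv_var eqxx mul1r mulr1 scaler_nat mulr2n.
by rewrite mpoly.mderivM mderiv_var eq_sym (negPf ji) mul0r mulr0 addr0.
Qed.

Lemma laplacianM p q : laplacian (p * q) =
  laplacian p * q + 2%:R *: (\sum_i d i p * d i q) + p * laplacian q.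
Proof.
rewrite /laplacian mulr_suml mulr_sumr scaler_sumr -!big_split /=.
apply: eq_bigr => i _; rewrite !(mpoly.mderivM, mpoly.mderivD) scaler_nat mulr2n.
by rewrite !addrA.
Qed.

Lemma laplacian_linear_form_exp s y : laplacian ('l y ^+ s) =
  ((s * s.-1)%:R * dotp y y) *: 'l y ^+ s.-2.
Proof.
rewrite /laplacian /dotp mulr_sumr scaler_suml; apply: eq_bigr => i _.
rewrite mderiv_exp mderiv_linear_form mpoly.mderivZ mpoly.mderivM.
rewrite mderiv_exp mderiv_linear_form mpoly.mderivZ mpoly.mderivC scaler0 mulr0 addr0.
by rewrite !mulr_algr !scalerA natrM; congr (_ *: _); ring.
Qed.

Lemma laplacian_sqr_norm_exp j : laplacian (r ^+ j) =
  (2 * j * (2 * j.-1 + n))%:R *: r ^+ j.-1.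
Proof.
case: j => [|j].
  rewrite /laplacian big1 ?muln0 ?scale0r // => i _.
  by rewrite expr0 mpoly.mderivC mpoly.mderiv0.
rewrite /laplacian.
have E i : d i (d i (r ^+ j.+1)) = 
   (2 * j.+1)%:R *: r ^+ j + (4 * j.+1 * j)%:R *: (r ^+ j.-1 * (Xv i * Xv i)).
  rewrite mderiv_exp mderiv_sqr_norm mpoly.mderivZ mpoly.mderivM.
  rewrite mderiv_exp mderiv_sqr_norm mpoly.mderivZ mderiv_var eqxx.
  rewrite -!(scalerAl, scalerAr) !scalerA mulr1 scalerDr !scalerA addrC.
  by rewrite -!natrM -mulrA; congr (_%:R *: _ + _%:R *: _); lia.
rewrite (eq_bigr _ (fun i _ => E i)) big_split /= sumr_const card_ord.
rewrite -scaler_sumr -mulr_sumr -/r scaler_nat -mulrnA.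
case: j {E} => [|j].
  by rewrite muln0 scale0r addr0 scaler_nat; congr (_ *+ _); lia.
by rewrite -exprSr !scaler_nat -mulrnDr; congr (_ *+ _); lia.
Qed.

(** These monomials in a linear form and the squared norm span the zonal
polynomials with axis [y]. *)
Lemma laplacian_mono s j y : dotp y y = 1 ->
  laplacian ('l y ^+ s * r ^+ j) =
    (s * s.-1)%:R *: ('l y ^+ s.-2 * r ^+ j)
    + (2 * j * (2 * s + 2 * j.-1 + n))%:R *: ('l y ^+ s * r ^+ j.-1).
Proof.
move=> y1; rewrite laplacianM laplacian_linear_form_exp laplacian_sqr_norm_exp.
rewrite y1 mulr1 -scalerAl -addrA; congr (_ + _).
rewrite -scalerAr.
suff -> : \sum_i d i ('l y ^+ s) * d i (r ^+ j) =
    (2 * s * j)%:R *: ('l y ^+ s * r ^+ j.-1).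
  by rewrite scalerA -natrM -scalerDl -natrD; congr (_%:R *: _); lia.
have E i : d i ('l y ^+ s) * d i (r ^+ j) =
   (2 * s * j)%:R *: ('l y ^+ s.-1 * r ^+ j.-1 * (y 0 i *: Xv i)).
  rewrite !mderiv_exp mderiv_linear_form mderiv_sqr_norm.
  rewrite -!(scalerAl, scalerAr) !scalerA mulr1 mulrA !natrM.
  by congr (_ *: _); ring.
rewrite (eq_bigr _ (fun i _ => E i)) -scaler_sumr -mulr_sumr -/(linear_form y).
case: s {E} => [|s]; first by rewrite muln0 mul0n !scale0r.
by rewrite mulrAC -exprSr.
Qed.

Lemma dir_deriv_linear_form_exp x y s :
  dir_deriv x ('l y ^+ s) = (s%:R * dotp x y) *: 'l y ^+ s.-1.
Proof.
rewrite /dir_deriv /dotp mulr_sumr scaler_suml; apply: eq_bigr => i _.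
rewrite mderiv_exp mderiv_linear_form -scalerAr mulr1 !scalerA.
by congr (_ *: _); ring.
Qed.

(** The reproducing property of the powers of a linear form. *)
Lemma fischer_mono x y s j : dotp x x = 1 ->
  fischer (s + 2 * j) ('l y ^+ s * r ^+ j) ('l x ^+ (s + 2 * j)) =
  ((s + 2 * j)`!)%:R ^+ 2 * dotp x y ^+ s.
Proof.
move=> x1; elim: j => [|j IHj].
  rewrite muln0 addn0 expr0 mulr1; elim: s => [|s IHs].
    by rewrite /= !expr0 mpoly.mcoeff1 eqxx fact0 expr1n.
  rewrite exprS fischer_mul_linear_form dir_deriv_linear_form_exp.
  rewrite fischerC fischerZl fischerC IHs factS natrM [dotp x y ^+ s.+1]exprS.
  rewrite (_ : dotp y x = dotp x y); first ring.
  by apply: eq_bigr => i _; rewrite mulrC.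
rewrite (_ : s + 2 * j.+1 = (s + 2 * j).+2)%N; last lia.
rewrite exprS mulrCA fischer_mul_sqr_norm laplacian_linear_form_exp x1 mulr1.
rewrite fischerC fischerZl fischerC IHj !factS !natrM.
by rewrite /=; ring.
Qed.

Lemma fischer_mul_sqr_norm_harmonic k p q :
  (1 < k)%N -> laplacian q = 0 -> fischer k (r * p) q = 0.
Proof.
case: k => [|[|k]] // _ q0.
by rewrite fischer_mul_sqr_norm q0 fischerC fischer0l mulr0.
Qed.

(** The homogeneous extension [x |-> |x|^k * g (x . y / |x|)] of a zonal function,
for [g] of degree [k] and of the parity of [k]. *)
Definition zonal (k : nat) (g : {poly R}) (y : 'rV[R]_n) : P :=
  \sum_(j < k./2.+1) g`_(k - 2 * j) *: ('l y ^+ (k - 2 * j) * r ^+ j).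

(** Each monomial of the zonal polynomial contributes two terms to the Laplacian.
The recurrence says that the second term of one monomial cancels the first
term of its neighbour, and the two end terms vanish. *)
Lemma zonal_harmonic k (g : {poly R}) y : dotp y y = 1 ->
  (forall i, (i.+2 <= k)%N ->
    (i.+2 * i.+1)%:R * g`_i.+2 = - ((k - i) * (k + i + n - 2))%:R * g`_i) ->
  laplacian (zonal k g y) = 0.
Proof.
move=> y1 rec; rewrite /zonal.
have -> : laplacian (\sum_(j < k./2.+1) g`_(k - 2 * j) *: ('l y ^+ (k - 2 * j) * r ^+ j)) =
  \sum_(j < k./2.+1) g`_(k - 2 * j) *: laplacian ('l y ^+ (k - 2 * j) * r ^+ j).
  rewrite /laplacian.
  transitivity (\sum_i \sum_(j < k./2.+1)
      g`_(k - 2 * j) *: d i (d i ('l y ^+ (k - 2 * j) * r ^+ j))).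
    apply: eq_bigr => i _; rewrite [t in d i t]mderiv_sum mderiv_sum; apply: eq_bigr => j _.
    by rewrite !mpoly.mderivZ.
  by rewrite exchange_big; apply: eq_bigr => j _; rewrite scaler_sumr.
under eq_bigr => j _ do rewrite laplacian_mono // scalerDr !scalerA.
rewrite big_split /= big_ord_recr [X in _ + X]big_ord_recl /=.
rewrite (_ : (k - 2 * k./2) * (k - 2 * k./2).-1 = 0)%N; last first.
  have := odd_double_half k; case: (odd k); lia.
rewrite !(mulr0, muln0, mul0n, scale0r) addr0 add0r -big_split big1 // => j _ /=.
rewrite /bump /= add1n.
have jk := ltn_ord j.
have jk2 : (2 * j.+1 <= k)%N by have := odd_double_half k; lia.
rewrite (_ : (k - 2 * j).-2 = k - 2 * j.+1)%N; last lia.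
rewrite -scalerDl; apply/eqP; rewrite scaler_eq0; apply/orP; left; apply/eqP.
have := rec (k - 2 * j.+1)%N.
rewrite (_ : (k - 2 * j.+1).+2 = k - 2 * j)%N; last lia.
move=> /(_ ltac:(lia)) E.
rewrite (_ : (k - 2 * j).-1 = (k - 2 * j.+1).+1); last lia.
rewrite mulrC E mulNr addrC mulrC; apply/eqP; rewrite subr_eq0; apply/eqP.
by congr ((_ * _)%:R * _); lia.
Qed.

(** If the zonal polynomials are harmonic, every monomial containing the squared
norm is orthogonal to them.  Hence only the leading monomial of [Z_x] counts in
[<Z_x, Z_y>], and by the reproducing property this product is a positive
multiple of [g (x . y)]. *)
Lemma gram_zonal k (g : {poly R}) :
  (forall i, (i.+2 <= k)%N ->
    (i.+2 * i.+1)%:R * g`_i.+2 = - ((k - i) * (k + i + n - 2))%:R * g`_i) ->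
  (forall t, g.[t] = \sum_(j < k./2.+1) g`_(k - 2 * j) * t ^+ (k - 2 * j)) ->
  0 < g`_k ->
  gram_kernel (fun x y : 'rV[R]_n => g.[dotp x y]).
Proof.
move=> rec gE gk.
apply: (@eq_gram_kernel _ _ (fun x y => (g`_k * (k`!)%:R ^+ 2)^-1 *
   fischer k (zonal k g x) (zonal k g y))); last first.
  apply: gram_kernelZ; last exact: gram_fischer.
  by rewrite invr_ge0 mulr_ge0 ?sqr_ge0 // ltW.
move=> x y x1 y1.
rewrite {1}/zonal fischer_suml big_ord_recl /= big1 ?addr0; last first.
  move=> j _; rewrite fischerZl /bump /= add1n.
  have jk2 : (2 * j.+1 <= k)%N by have := ltn_ord j; have := odd_double_half k; lia.
  rewrite exprS mulrCA fischer_mul_sqr_norm_harmonic ?mulr0 //; first lia.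
  exact: zonal_harmonic.
rewrite muln0 subn0 expr0 mulr1 fischerZl fischerC {1}/zonal fischer_suml.
rewrite -[fischer k]/(fischer k).
rewrite (eq_bigr (fun j : 'I_k./2.+1 =>
    (k`!)%:R ^+ 2 * (g`_(k - 2 * j) * dotp x y ^+ (k - 2 * j)))); last first.
  move=> j _; rewrite fischerZl.
  have jk2 : (2 * j <= k)%N by have := ltn_ord j; have := odd_double_half k; lia.
  have := @fischer_mono x y (k - 2 * j) j x1.
  by rewrite subnK // => ->; rewrite mulrCA.
rewrite -mulr_sumr -gE; field.
by rewrite pnatr_eq0 -lt0n fact_gt0 gt_eqF.
Qed.

End Fischer.

(** * Integration against the Gegenbauer weight *)

Section Exhaustion.
Variable R : realType.
Local Notation mu := (@lebesgue_measure R).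

(** For [n = 2] the Gegenbauer weight is unbounded at [-1] and [1], so integrals
are computed on the inner intervals and passed to the limit. *)
Definition inner_end (k : nat) : R := 1 - k.+2%:R^-1.
Definition inner_itv (k : nat) : set R := `[- inner_end k, inner_end k].

Lemma inner_end_gt0_lt1 k : 0 < inner_end k < 1.
Proof.
rewrite /inner_end subr_gt0 ltrBlDr ltrDl invr_gt0 ltr0n andbT.
by rewrite invf_lt1 ?ltr0n // ltr1n.
Qed.

Lemma inner_itv_oo k (t : R) : inner_itv k t -> -1 < t < 1.
Proof.
rewrite /inner_itv /= in_itv /=; have := inner_end_gt0_lt1 k; lra.
Qed.

Lemma inner_end_nondecreasing : nondecreasing_seq inner_end.
Proof.
move=> k l kl; rewrite lerB // lef_pV2 ?posrE ?ltr0n // ler_nat.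
by rewrite !ltnS.
Qed.

Lemma inner_itv_nondecreasing : nondecreasing_seq inner_itv.
Proof.
move=> k l kl; rewrite subsetEset /inner_itv => t /=; rewrite !in_itv /=.
by have := inner_end_nondecreasing kl; lra.
Qed.

Lemma inner_itv_large (t : R) : -1 < t < 1 -> \forall k \near \oo, inner_itv k t.
Proof.
move=> t1; have [k _ tk] : exists2 k : nat, True & `|t| + k.+1%:R^-1 < 1.
  have [|k tk] := @ltr_add_invr R `|t| 1; last by exists k.
  by rewrite ltr_norml.
exists k => // l /= kl; rewrite /inner_itv /= in_itv /=.
have : `|t| <= inner_end l.
  apply: (le_trans _ (inner_end_nondecreasing kl)); rewrite /inner_end.
  have : k.+2%:R^-1 <= k.+1%:R^-1 :> R by rewrite lef_pV2 ?posrE ?ltr0n // ler_nat.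
  by move=> k2; rewrite lerBrDr ltW // (le_lt_trans _ tk) // lerD2l.
by rewrite ler_norml.
Qed.

Lemma bigcup_inner_itv : \bigcup_k inner_itv k = `]-1, 1[%classic :> set R.
Proof.
apply/seteqP; split => [t [k _ /inner_itv_oo]|t] /=; rewrite in_itv //=.
by move=> /inner_itv_large[k _ /(_ k (leqnn k))]; exists k.
Qed.

Lemma measurable_inner_itv k : measurable (inner_itv k).
Proof. exact: measurable_itv. Qed.

Lemma integral_inner_itv (g G : R -> R) k :
  (forall t : R, -1 < t < 1 -> is_derive t (1 : R) G (g t)) ->
  (forall t : R, -1 < t < 1 -> derivable g t 1) ->
  (\int[mu]_(t in inner_itv k) (g t)%:E)%E =
  (G (inner_end k) - G (- inner_end k))%:E.
Proof.
move=> dG dg; have c01 := inner_end_gt0_lt1 k.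
have in1 t : t \in `[- inner_end k, inner_end k] -> -1 < t < 1.
  exact: inner_itv_oo.
have in1' t : t \in `]- inner_end k, inner_end k[ -> -1 < t < 1.
  by move=> /subset_itv_oo_cc; exact: in1.
have dGk : forall t : R, -1 < t < 1 -> derivable G t 1 by move=> t /dG[].
have cG (t : R) : -1 < t < 1 -> G @ t --> G t.
  by move=> t1; apply/differentiable_continuous/derivable1_diffP/dGk.
rewrite EFinB; apply: continuous_FTC2.
- lra.
- by apply: derivable_within_continuous => t /in1; apply: dg.
- split.
  + by move=> t /in1'; apply: dGk.
  + by apply: cvg_at_right_filter; apply: cG; lra.
  + by apply: cvg_at_left_filter; apply: cG; lra.
- by move=> t /in1' /dG dGt; rewrite derive1E; have [_ ->] := dGt.
Qed.

Lemma cvg_integral_inner_itv (g : R -> R) :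
  mu.-integrable `[-1, 1] (EFin \o g) ->
  (\int[mu]_(t in inner_itv k) (g t)%:E)%E @[k --> \oo] -->
  (\int[mu]_(t in `[(-1)%R, 1%R]) (g t)%:E)%E.
Proof.
move=> ig.
rewrite integral_itv_bndoo //; last first.
  have := measurable_int _ ig; apply: measurable_funS => //.
  exact: subset_itv_oo_cc.
have ig' : mu.-integrable `](-1)%R, 1%R[ (EFin \o g).
  by apply: integrableS ig => //; exact: subset_itv_oo_cc.
have sub k : inner_itv k `<=` `](-1)%R, 1%R[.
  by move=> t /inner_itv_oo /=; rewrite in_itv.
pose f_ k (t : R) := (g t * \1_(inner_itv k) t)%:E.
rewrite (_ : (fun k => _) = fun k => (\int[mu]_(t in `](-1)%R, 1%R[) f_ k t)%E); last first.
  apply/funext => k; rewrite -[in LHS](setIidr (@sub k)) integral_mkcondr.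
  apply: eq_integral => t _; rewrite patchE /f_ indicE.
  by case: ifPn => _; rewrite ?mulr1 ?mulr0.
have mg := measurable_int _ ig'.
have [|||||_ _ //] := @dominated_convergence _ _ R mu _ (measurable_itv `](-1)%R, 1%R[)
  f_ (EFin \o g) (fun t => `|(g t)%:E|%E).
- move=> k; apply/measurable_EFinP/measurable_funM; first exact/measurable_EFinP.
  by apply: measurable_indic; exact: measurable_inner_itv.
- by [].
- apply: aeW => t t1; apply: cvg_near_cst.
  have /inner_itv_large : -1 < t < 1 by move: t1; rewrite /= in_itv.
  by apply: filterS => k kt; rewrite /f_ indicE mem_set // mulr1.
- exact: integrable_abse.
- apply: aeW => t k _; rewrite /f_ /= lee_fin normrM ler_piMr // indicE.
  by case: (_ \in _); rewrite ?normr1 ?normr0.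
Qed.

Lemma cvg_inner_end : inner_end @ \oo --> (1 : R).
Proof.
rewrite -[X in _ --> X]subr0; apply: cvgB; first exact: cvg_cst.
by have := @cvg_harmonic R; rewrite -(cvg_shiftS _).
Qed.

End Exhaustion.

Section GegenbauerWeight.
Variables (R : realType) (n : nat).
Hypothesis n_ge2 : (2 <= n)%N.
Local Notation mu := (@lebesgue_measure R).

Definition sphere_weight (t : R) : R := (1 - t ^+ 2) `^ ((n%:R - 3) / 2).

Lemma is_derive_weight_power (a t : R) : -1 < t < 1 ->
  is_derive t (1 : R) (fun t : R => (1 - t ^+ 2) `^ a)
    (a * (1 - t ^+ 2) `^ (a - 1) * (- (2 * t))).
Proof.
move=> t1.
have p0 : 0 < 1 - t ^+ 2 by nra.
have d1 : is_derive t (1 : R) (fun t : R => 1 - t ^+ 2) (- (2 * t)).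
  by apply: is_derive_eq; rewrite /GRing.scale /=; ring.
exact: (@is_derive1_comp _ (fun y : R => y `^ a) (fun t : R => 1 - t ^+ 2) t _ _
  (is_derive1_powR a p0) d1).
Qed.

Lemma derivable_weight t : -1 < t < 1 -> derivable sphere_weight t 1.
Proof. by move=> t1; have [] := is_derive_weight_power ((n%:R - 3) / 2) t1. Qed.

Lemma measurable_weight (D : set R) : measurable_fun D sphere_weight.
Proof.
apply: measurable_funTS; apply: (measurableT_comp (measurable_powR _)).
by apply: measurable_funB => //; exact: measurable_funX.
Qed.

Lemma sphere_weight_ge0 t : 0 <= sphere_weight t.
Proof. exact: powR_ge0. Qed.

Lemma sphere_weight_gt0 t : -1 < t < 1 -> 0 < sphere_weight t.
Proof. by move=> t1; apply: powR_gt0; nra. Qed.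

(** The bound is the derivative of the arcsine, which is bounded. *)
Lemma sphere_weight_le t : -1 < t < 1 ->
  sphere_weight t <= (1 - t ^+ 2) `^ (- 2^-1).
Proof.
move=> t1; apply: ger_powR; first by apply/andP; split; nra.
have : 2 <= n%:R :> R by rewrite ler_nat.
lra.
Qed.

Lemma integrable_weight : mu.-integrable `[-1, 1] (EFin \o sphere_weight).
Proof.
apply/integrableP; split; first by apply/measurable_EFinP; apply: measurable_weight.
rewrite integral_itv_bndoo; last first.
  by apply: measurableT_comp => //; apply/measurable_EFinP; apply: measurable_weight.
rewrite -bigcup_inner_itv.
have cv : (\int[mu]_(t in @inner_itv R k) `|(sphere_weight t)%:E|)%E @[k --> \oo] -->
    (\int[mu]_(t in \bigcup_k @inner_itv R k) `|(sphere_weight t)%:E|)%E.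
  apply: ge0_nondecreasing_set_cvg_integral => //.
  - exact: inner_itv_nondecreasing.
  - exact: measurable_inner_itv.
  - by move=> i; apply: measurableT_comp => //; apply/measurable_EFinP; apply: measurable_weight.
apply: (@le_lt_trans _ _ (pi : R)%:E); last exact: ltry.
rewrite -(cvg_lim _ cv) //; apply: lime_le; first by apply/cvg_ex; eexists; exact: cv.
apply: nearW => k.
have das (t : R) : -1 < t < 1 ->
    is_derive t (1 : R) (@asin R) ((1 - t ^+ 2) `^ (- 2^-1)).
  move=> t1; rewrite powRN powR12_sqrt; last nra.
  exact: is_derive1_asin.
have dpow (t : R) : -1 < t < 1 ->
    derivable (fun t : R => (1 - t ^+ 2) `^ (- 2^-1)) t 1.
  by move=> t1; have [] := is_derive_weight_power (- 2^-1) t1.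
apply: (@le_trans _ _ (\int[mu]_(t in @inner_itv R k) ((1 - t ^+ 2) `^ (- 2^-1))%:E)%E).
  apply: ge0_le_integral => //.
  - exact: measurable_inner_itv.
  - by apply: measurableT_comp => //; apply/measurable_EFinP; apply: measurable_weight.
  - apply/measurable_EFinP; apply: measurable_funTS.
    apply: (measurableT_comp (measurable_powR _)).
    by apply: measurable_funB => //; exact: measurable_funX.
  - move=> t /inner_itv_oo t1; rewrite /= lee_fin ger0_norm ?sphere_weight_ge0 //.
    exact: sphere_weight_le.
rewrite (integral_inner_itv _ das dpow) lee_fin.
have /andP[c0 c1] := inner_end_gt0_lt1 R k.
have := @asin_lepi2 R (@inner_end R k); have := @asin_geNpi2 R (- @inner_end R k).
lra.
Qed.

Definition sphere_integral (q : {poly R}) : R :=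
  fine (\int[mu]_(t in `[(-1)%R, 1%R]) (q.[t] * sphere_weight t)%:E)%E.

Lemma integrable_poly_weight (q : {poly R}) :
  mu.-integrable `[-1, 1] (EFin \o (fun t => q.[t] * sphere_weight t)).
Proof.
have -> : EFin \o (fun t => q.[t] * sphere_weight t) =
    ((EFin \o horner q) \* (EFin \o sphere_weight))%E by [].
apply: integrableMr => //; last exact: integrable_weight.
  by apply: measurable_funTS; apply: continuous_measurable_fun; exact: continuous_horner.
have cq : {within `[(-1 : R), 1], continuous (horner q)}.
  by apply: continuous_subspaceT => ?; exact: continuous_horner.
have /compact_bounded[M [Mr MP]] := continuous_compact cq (@segment_compact R (-1) 1).
by exists M; split => // x Mx t /= t1; apply: MP => //; exists t.
Qed.

Lemma sphere_integralE q : (sphere_integral q)%:E =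
  (\int[mu]_(t in `[(-1)%R, 1%R]) (q.[t] * sphere_weight t)%:E)%E.
Proof.
rewrite /sphere_integral fineK //; apply: integrable_fin_num => //.
exact: integrable_poly_weight.
Qed.

Lemma sphere_integral_is_scalar : scalar sphere_integral.
Proof.
move=> a p q; apply: EFin_inj; rewrite EFinD EFinM !sphere_integralE.
rewrite -integralZl //; last exact: integrable_poly_weight.
rewrite -integralD //; last exact: integrable_poly_weight; last first.
  by apply: integrableZl => //; exact: integrable_poly_weight.
apply: eq_integral => t _; rewrite -EFinM -EFinD; congr EFin.
by rewrite hornerD hornerZ; ring.
Qed.

HB.instance Definition _ := GRing.isLinear.Build R {poly R} R *%R
  sphere_integral sphere_integral_is_scalar.

(** The left-hand side is the integral of the derivative of
[(1 - t^2)^((n - 1) / 2) * q], which vanishes at both ends. *)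
Lemma sphere_integral_parts (q : {poly R}) :
  sphere_integral ((1 - 'X^2) * q^`() - (n.-1)%:R *: ('X * q)) = 0.
Proof.
set p := _ - _; pose b : R := (n%:R - 1) / 2.
pose G (t : R) := (1 - t ^+ 2) `^ b * q.[t].
have nE : (n.-1)%:R = n%:R - 1 :> R by rewrite -subn1 natrB // ltnW.
have dG (t : R) : -1 < t < 1 -> is_derive t (1 : R) G (p.[t] * sphere_weight t).
  move=> t1; have p0 : 0 < 1 - t ^+ 2 by nra.
  have db := is_derive_weight_power b t1.
  apply: (@is_derive_eq _ _ _ _ _ _ _ _ (is_deriveM db (is_derive_poly q t))).
  rewrite /GRing.scale /=.
  have -> : b - 1 = (n%:R - 3) / 2 by rewrite /b; field.
  (* The weight is the power of exponent [b - 1]. *)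
  have -> : (1 - t ^+ 2) `^ b = (1 - t ^+ 2) * sphere_weight t.
    rewrite /sphere_weight -{2}(powRr1 (ltW p0)) -powRD; last first.
      by apply/implyP => _; rewrite gt_eqF.
    by congr (_ `^ _); rewrite /b; field.
  by rewrite -/(sphere_weight t) /p !hornerE nE /b /=; field.
have dg (t : R) : -1 < t < 1 -> derivable (fun t => p.[t] * sphere_weight t) t 1.
  by move=> t1; apply: derivableM; [exact: derivable_horner|exact: derivable_weight].
apply: EFin_inj; rewrite sphere_integralE.
have cv := cvg_integral_inner_itv (integrable_poly_weight p).
apply: (cvg_unique _ cv) => //.
rewrite (_ : (fun k => _) = (fun k => (G (@inner_end R k) - G (- @inner_end R k))%:E)); last first.
  by apply/funext => k; exact: (integral_inner_itv k dG dg).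
apply: cvg_EFin; first exact: nearW.
rewrite -[X in _ --> X](subrr (0 * q.[1])) -{2}(_ : 0 * q.[-1] = 0 * q.[1]); last by rewrite !mul0r.
have cb : (1 - (@inner_end R k) ^+ 2) `^ b @[k --> \oo] --> 0.
  apply: (@squeeze_cvgr _ _ _ _ (fun=> 0) (fun k => Num.sqrt (1 - (@inner_end R k) ^+ 2))).
  - apply: nearW => k; rewrite powR_ge0 /=.
    have c1 := inner_end_gt0_lt1 R k.
    rewrite -powR12_sqrt; last nra.
    apply: ger_powR; first by apply/andP; split; nra.
    have : 2 <= n%:R :> R by rewrite ler_nat.
    by rewrite /b; lra.
  - exact: cvg_cst.
  - rewrite -[X in _ --> X]sqrtr0 -(_ : 1 - 1 ^+ 2 = 0); last by rewrite expr1n subrr.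
    apply: continuous_cvg; first exact: sqrt_continuous.
    by apply: cvgB; [exact: cvg_cst|apply: cvgM; exact: cvg_inner_end].
apply: cvgB; apply: cvgM.
- exact: cb.
- by apply: continuous_cvg; [exact: continuous_horner|exact: cvg_inner_end].
- by under eq_fun do rewrite sqrrN; exact: cb.
- by apply: continuous_cvg; [exact: continuous_horner|apply: cvgN; exact: cvg_inner_end].
Qed.

(** If the integral vanished, the nonnegative integrand would vanish almost
everywhere, hence the interval would be covered by a null set and the finitely
many roots of [q]. *)
Lemma sphere_integral_gt0 (q : {poly R}) : q != 0 ->
  (forall t : R, -1 <= t <= 1 -> 0 <= q.[t]) -> 0 < sphere_integral q.
Proof.
move=> q0 q_ge0.
have h0 t : `[-1, 1]%classic t -> (0 <= (q.[t] * sphere_weight t)%:E)%E.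
  by rewrite /= in_itv /= => t1; rewrite lee_fin mulr_ge0 ?sphere_weight_ge0 ?q_ge0.
rewrite -lte_fin sphere_integralE lt_neqAle; apply/andP; split; last first.
  exact: integral_ge0.
rewrite eq_sym; apply/negP => /eqP e0.
have [m2 _] := (integrableP _ _ _ (integrable_poly_weight q)).
have : (\int[mu]_(t in `[(-1)%R, 1%R]) `|(q.[t] * sphere_weight t)%:E| = 0)%E.
  by rewrite -[RHS]e0; apply: eq_integral => t; rewrite inE => t1; rewrite gee0_abs // h0.
move/(iffLR (ae_eq_integral_abs mu (measurable_itv _) m2)) => -[N [mN N0 subN]].
pose Z := [set t : R | root q t].
have cZ : countable Z.
  apply: finite_set_countable; apply: contrapT => /infinite_set_fset -/(_ (size q))[B BZ sB].
  have := @max_poly_roots _ q (finmap.enum_fset B) q0.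
  rewrite finmap.fset_uniq => /(_ _ isT).
  rewrite ltnNge sB => /(_ _)/notF; apply.
  by apply/allP => t tB; exact: BZ.
have cover : `](-1)%R, 1%R[ `<=` N `|` Z.
  move=> t; rewrite /= in_itv /= => t1; have [qt|qt] := pselect (Z t); [by right|left].
  apply: subN => /= h; have : `[-1, 1]%classic t by rewrite /= in_itv /=; lra.
  move=> /h /eqP; rewrite /= eqe mulf_eq0 (gt_eqF (sphere_weight_gt0 t1)) orbF.
  exact: qt.
have mZ : measurable Z by exact: countable_measurable.
have : (mu `](-1)%R, 1%R[ <= mu N + mu Z)%E.
  apply: le_trans (measureU2 _ _ _) => //.
  by apply: le_measure => //; rewrite inE //; exact: measurableU.
rewrite N0 (countable_lebesgue_measure0 cZ) adde0 lebesgue_measure_itv /= lte_fin.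
by case: ifPn => [_|]; rewrite ?EFinB ?lee_fin; lra.
Qed.

Definition sphere_functional : {scalar {poly R}} := sphere_integral.

End GegenbauerWeight.

(** * Gegenbauer polynomials as positive semidefinite kernels *)

Section ParitySum.
Variable V : nmodType.

Lemma sum_same_parity (F : nat -> V) k :
  (forall i, (i <= k)%N -> odd (k - i) -> F i = 0) ->
  \sum_(i < k.+1) F i = \sum_(j < k./2.+1) F (k - 2 * j)%N.
Proof.
elim/ltn_ind: k F => -[|[|k]] IHk F F0.
- by rewrite !big_ord_recl !big_ord0.
- by rewrite !big_ord_recl !big_ord0 /= !addr0 (F0 0%N) // add0r.
rewrite big_ord_recr big_ord_recr /= (F0 k.+1) //; last by rewrite subSnn.
rewrite addr0 (IHk k) => [|//|i ik oi]; last first.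
  by apply: F0; [rewrite !leqW|rewrite subSn ?leqW // subSn //= negbK].
rewrite [RHS](big_ord_recl k./2.+1) /= muln0 subn0 addrC; congr (_ + _).
by apply: eq_bigr => j _; congr F; rewrite /bump /=; lia.
Qed.

End ParitySum.

Section Gegenbauer.
Variables (R : realType) (n : nat).
Hypothesis n_ge2 : (2 <= n)%N.
Local Notation L := (sphere_functional R n_ge2).
Local Notation P := (gegenbauer R n).
Implicit Types p q r : {poly R}.

Lemma sphere_functional_gt0 p : p != 0 ->
  (forall t : R, -1 <= t <= 1 -> 0 <= p.[t]) -> 0 < L p.
Proof. exact: sphere_integral_gt0. Qed.

Lemma sphere_functional_positive k : positive_upto L k.
Proof.
move=> q q0 _; apply: sphere_functional_gt0; first by rewrite mulf_neq0.
by move=> t _; rewrite hornerM -expr2 sqr_ge0.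
Qed.

Lemma sphere_functional_shift_positive k : positive_upto (shift_functional 1 L) k.
Proof.
move=> q q0 _; apply: sphere_functional_gt0.
  rewrite !mulf_neq0 // -size_poly_gt0 -opprB size_polyN size_XsubC //.
move=> t /andP[_ t1]; rewrite !hornerM mulr_ge0 //.
  by rewrite hornerD hornerN hornerC hornerX subr_ge0.
by rewrite -expr2 sqr_ge0.
Qed.

Lemma sphere_functional_orth_poly_gt0 k Q : orth_poly L k Q -> 0 < Q.[1].
Proof.
move=> oQ; apply: (@orth_poly_gt0 _ L 1 k.+1 k Q) => //.
- exact: sphere_functional_positive.
- exact: sphere_functional_shift_positive.
Qed.

(** From the extended real integrals of the definition to a linear functional. *)
Lemma is_gegenbauerP k p : is_gegenbauer n k p <->
  [/\ size p = k.+1, p.[1] = 1 & forall q, (size q <= k)%N -> L (p * q) = 0].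
Proof.
have LE q : (L (p * q))%:E = (\int[@lebesgue_measure R]_(t in `[(-1)%R, 1%R])
    (p.[t] * q.[t] * (1 - t ^+ 2) `^ ((n%:R - 3) / 2))%R%:E)%E.
  rewrite [LHS]sphere_integralE //; apply: eq_integral => t _.
  by rewrite hornerM.
split=> -[sp p1 po]; split=> // q sq; last by rewrite -LE po.
by apply: EFin_inj; rewrite LE po.
Qed.

(** An orthogonal polynomial is positive at [1], the right end of the support, so
it can be normalized there. *)
Lemma gegenbauerP k :
  [/\ size (P k) = k.+1, (P k).[1] = 1
    & forall q, (size q <= k)%N -> L (P k * q) = 0].
Proof.
apply/is_gegenbauerP; apply: xgetPex.
have [ O oO] := orth_poly_exists (@sphere_functional_positive k).
have [sO lO OP] := oO; have O1 := sphere_functional_orth_poly_gt0 oO.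
exists (O.[1]^-1 *: O); apply/is_gegenbauerP; split.
- by rewrite size_scale // invr_neq0 // gt_eqF.
- by rewrite hornerZ mulVf // gt_eqF.
- by move=> q sq; rewrite -scalerAl functionalZ OP // mulr0.
Qed.

Lemma size_gegenbauer k : size (P k) = k.+1.
Proof. by have [] := gegenbauerP k. Qed.

Lemma gegenbauer0 : P 0 = 1.
Proof.
have [sP P1 _] := gegenbauerP 0.
have /size_poly1P[a _ Pa] : size (P 0) == 1%N by rewrite sP.
by move: P1; rewrite Pa hornerC => ->.
Qed.

Lemma orth_gegenbauer k : orth_poly L k (P k).
Proof.
have [sP P1 oP] := gegenbauerP k; split => //.
rewrite ltNge; apply/negP => lP.
have : orth_poly L k (- P k).
  split; first by rewrite size_polyN.
    by rewrite lead_coefN oppr_gt0 lt_neqAle lP lead_coef_eq0 -size_poly_gt0 sP.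
  by move=> q sq; rewrite mulNr linearN /= oP // oppr0.
by move/sphere_functional_orth_poly_gt0; rewrite hornerN P1; lra.
Qed.

(** The Laplace-Beltrami operator of the sphere on zonal functions. *)
Definition spherical_laplacian q : {poly R} :=
  (1 - 'X^2) * q^`()^`() - (n.-1)%:R *: ('X * q^`()).

(** Green formula; the right-hand side is symmetric in [p] and [q]. *)
Lemma sphere_functional_laplacian p q :
  L (spherical_laplacian p * q) = - L ((1 - 'X^2) * p^`() * q^`()).
Proof.
have : L ((1 - 'X^2) * (p^`() * q)^`() - (n.-1)%:R *: ('X * (p^`() * q))) = 0.
  exact: sphere_integral_parts.
rewrite (_ : _ - _ = spherical_laplacian p * q + (1 - 'X^2) * p^`() * q^`()).
  by rewrite linearD /= => /eqP; rewrite addr_eq0 => /eqP.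
by rewrite derivM /spherical_laplacian -!mul_polyC; ring.
Qed.

Lemma sphere_functional_laplacian_sym p q :
  L (spherical_laplacian p * q) = L (p * spherical_laplacian q).
Proof.
rewrite [in RHS]mulrC !sphere_functional_laplacian.
by congr (- L _); rewrite mulrAC.
Qed.

Lemma coef_spherical_laplacian q i :
  (spherical_laplacian q)`_i =
    (i.+2 * i.+1)%:R * q`_i.+2 - (i * (i + n - 2))%:R * q`_i.
Proof.
rewrite /spherical_laplacian mulrBl mul1r !coefB coefZ ['X^2 * _]mulrC coefMXn.
rewrite ['X * _]mulrC coefMX !coef_deriv.
case: i => [|[|i]] /=.
- by rewrite mulr0 !mul0n mul0r !subr0 -mulrnA mulr_natl.
- rewrite subr0 -mulrnA !mulr1n (_ : (1 * (1 + n - 2))%N = n.-1); last lia.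
  by rewrite mulr_natl.
- rewrite subn2 /=.
  have nE : (n.-1)%:R = n%:R - 1 :> R by rewrite -subn1 natrB // ltnW.
  have iE : (i.+2 + n - 2)%:R = i%:R + n%:R :> R by rewrite -natrD; congr _%:R; lia.
  have i1 : i.+1%:R = i%:R + 1 :> R by rewrite natr1.
  have i2 : i.+2%:R = i%:R + 2 :> R by rewrite -natrD addn2.
  move: (q`_i.+4) (q`_i.+2) => a b.
  rewrite -!mulrnA -[a *+ _]mulr_natr -[b *+ (i.+2 * _)]mulr_natr -[b *+ i.+2]mulr_natr.
  rewrite !natrM iE nE i1 i2; move: (i.+4%:R) (i.+3%:R) (i%:R) (n%:R) => u v x y.
  by ring.
Qed.

Lemma size_spherical_laplacian q k :
  (size q <= k)%N -> (size (spherical_laplacian q) <= k)%N.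
Proof.
move=> sq; apply/leq_sizeP => i ki; rewrite coef_spherical_laplacian.
by rewrite !nth_default ?mulr0 ?subrr // ?(leq_trans sq) // ?(leq_trans ki) // ltnW.
Qed.

(** The operator is symmetric and does not raise degrees, so the image of an
orthogonal polynomial is orthogonal to all lower degrees, hence proportional to
it. *)
Lemma gegenbauer_laplacian k :
  spherical_laplacian (P k) = - (k * (k + n - 2))%:R *: P k.
Proof.
have [sP lP oP] := orth_gegenbauer k.
apply/eqP; rewrite -subr_eq0; apply/contraT => D0.
set D := _ - _ in D0.
have sT : (size (spherical_laplacian (P k)) <= k.+1)%N.
  by apply: size_spherical_laplacian; rewrite sP.
(* The leading terms cancel, and [D] is orthogonal to all lower degrees. *)
have sD : (size D <= k)%N.
  have := size_sub_leading sP sT; rewrite coef_spherical_laplacian.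
  rewrite nth_default ?sP // mulr0 sub0r -mulNr.
  by rewrite -[(P k)`_k]/((P k)`_(k.+1.-1)) -sP -lead_coefE mulfK ?gt_eqF.
have := sphere_functional_positive D0 (leqnn _).
rewrite {1}/D mulrBl -scalerAl linearB /= functionalZ oP // mulr0 subr0.
rewrite sphere_functional_laplacian_sym oP ?size_spherical_laplacian //.
by rewrite ltxx.
Qed.

Lemma gegenbauer_coef_rec k i : (i <= k)%N ->
  (i.+2 * i.+1)%:R * (P k)`_i.+2 =
    - ((k - i) * (k + i + n - 2))%:R * (P k)`_i.
Proof.
move=> ik; have := congr1 (fun p : {poly R} => p`_i) (gegenbauer_laplacian k).
rewrite coef_spherical_laplacian coefZ => /eqP; rewrite subr_eq => /eqP ->.
rewrite -mulrDl; congr (_ * _).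
have -> : (k * (k + n - 2) = (k - i) * (k + i + n - 2) + i * (i + n - 2))%N.
  have [d ->] : exists d, k = (i + d)%N by exists (k - i)%N; lia.
  have [e ->] : exists e, n = e.+2 by exists (n - 2)%N; lia.
  by rewrite !addnS !subSS !subn0 addKn; ring.
by rewrite natrD opprD addrNK.
Qed.

(** The recurrence goes down from the coefficient of index [k + 1], which is zero. *)
Lemma gegenbauer_coef_odd k i : (i <= k)%N -> odd (k - i) -> (P k)`_i = 0.
Proof.
move=> ik oki; have [d kE] : exists d, k = (i + (2 * d).+1)%N.
  exists (k - i)./2; have := odd_double_half (k - i); rewrite oki; lia.
elim: d i kE {ik oki} => [|d IHd] i kE.
  have := @gegenbauer_coef_rec k i _; rewrite nth_default ?size_gegenbauer; last lia.
  move=> /(_ ltac:(lia)) /esym/eqP; rewrite mulr0 mulf_eq0 oppr_eq0 pnatr_eq0 muln_eq0.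
  by case/orP => [/orP[]|]/eqP //; lia.
have := @gegenbauer_coef_rec k i _; rewrite (IHd i.+2); last lia.
move=> /(_ ltac:(lia)) /esym/eqP; rewrite mulr0 mulf_eq0 oppr_eq0 pnatr_eq0 muln_eq0.
by case/orP => [/orP[]|]/eqP //; lia.
Qed.

Lemma gram_gegenbauer k :
  gram_kernel (fun x y : 'rV[R]_n => (P k).[dotp x y]).
Proof.
have [sP lP _] := orth_gegenbauer k.
apply: (@gram_zonal _ _ k (P k)).
- by move=> i ik; apply: gegenbauer_coef_rec; lia.
- move=> t; rewrite (horner_coef_wide _ (eq_leq sP)).
  rewrite (@sum_same_parity _ (fun i => (P k)`_i * t ^+ i)) //.
  by move=> i ik oi; rewrite gegenbauer_coef_odd // mul0r.
- by move: lP; rewrite lead_coefE sP.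
Qed.

(** [P_(2 k + e) (t) = t ^ e * H_k (t ^ 2)] defines [H_k], by parity. *)
Definition half_gegenbauer (e : bool) k : {poly R} :=
  (if e then @odd_poly R else @even_poly R) (P (2 * k + e)).

Lemma gegenbauer_half (e : bool) k :
  P (2 * k + e) = 'X^e * (half_gegenbauer e k \Po 'X^2).
Proof.
rewrite -{1}[P _]poly_even_odd /half_gegenbauer mulrC; case: e => /=.
  rewrite (_ : even_poly _ = 0) ?comp_poly0 ?add0r //.
  apply/polyP => i; rewrite coef_even_poly coef0.
  have [ik|ik] := leqP i.*2 (2 * k + 1); last by rewrite nth_default // size_gegenbauer.
  apply: gegenbauer_coef_odd => //; rewrite oddB //; lia.
rewrite (_ : odd_poly _ = 0) ?comp_poly0 ?mulr0 ?addr0 ?expr0 ?mul1r //.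
apply/polyP => i; rewrite coef_odd_poly coef0.
have [ik|ik] := leqP i.*2.+1 (2 * k + 0); last by rewrite nth_default // size_gegenbauer.
apply: gegenbauer_coef_odd => //; rewrite oddB //; lia.
Qed.

Lemma size_half_gegenbauer e k : size (half_gegenbauer e k) = k.+1.
Proof.
have sP := size_gegenbauer (2 * k + e); rewrite /half_gegenbauer; case: e sP => sP.
  rewrite size_odd_poly_eq sP; lia.
rewrite size_even_poly_eq sP; lia.
Qed.

Lemma lead_coef_half_gegenbauer e k : 0 < lead_coef (half_gegenbauer e k).
Proof.
have [sP lP _] := orth_gegenbauer (2 * k + e).
rewrite lead_coefE size_half_gegenbauer /=; move: lP; rewrite lead_coefE sP /=.
rewrite /half_gegenbauer; case: e {sP} => /=.
  by rewrite coef_odd_poly addn1 mul2n.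
by rewrite coef_even_poly addn0 mul2n.
Qed.

End Gegenbauer.

(** * Rolle's theorem and Hermite interpolation *)

Section Rolle.
Variable R : realType.
Implicit Types (g : R -> R) (s d : seq R).

(** The zeros produced avoid those of [g]: when [g] has double zeros, these are
further zeros of the derivative. *)
Lemma rolle_zeros g g' s :
  sorted <%R s ->
  (forall a b, a \in s -> b \in s -> a < b -> {within `[a, b], continuous g}) ->
  (forall a, a \in s -> 0 <= a <= 1) ->
  (forall t : R, 0 < t < 1 -> is_derive t (1 : R) g (g' t)) ->
  (forall a, a \in s -> g a = 0) ->
  exists s', [/\ sorted <%R s', size s' = (size s).-1,
    forall c, c \in s' -> [/\ 0 < c < 1, g' c = 0 & c \notin s]
    & forall c, c \in s' -> head 0 s < c].
Proof.
elim: s => [|a s IHs]; first by exists [::].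
case: s IHs => [|b s] IHs; first by exists [::].
move=> /= /andP[ab pbs] cg s01 dg zg.
have sub c : c \in b :: s -> c \in [:: a, b & s] by rewrite [in X in _ -> X]inE => ->; rewrite orbT.
have [||||s' [ss' size_s' s'P s'_gt]] := IHs.
- by [].
- by move=> c d cs ds; apply: cg; apply: sub.
- by move=> c cs; apply: s01; apply: sub.
- by move=> c cs; apply: zg; apply: sub.
have a01 : 0 <= a <= 1 by apply: s01; rewrite mem_head.
have b01 : 0 <= b <= 1 by apply: s01; rewrite sub // mem_head.
have ga : g a = 0 by apply: zg; rewrite mem_head.
have gb : g b = 0 by apply: zg; rewrite sub // mem_head.
have itv01 t : t \in `]a, b[ -> 0 < t < 1.
  rewrite in_itv /=; move: a01 b01; lra.
have [|||c cab] := @Rolle R g a b ab.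
- by move=> t /itv01 /dg [].
- by apply: cg; rewrite ?mem_head ?sub ?mem_head.
- by rewrite ga gb.
have c01 := itv01 _ cab.
move: cab; rewrite in_itv /= => /andP[ac cb] dgc.
have g'c : g' c = 0.
  by have [_ <-] := dg c c01; have [_ ->] := dgc.
exists (c :: s'); split => /=.
- rewrite path_sortedE; last exact: lt_trans.
  rewrite ss' andbT; apply/allP => t /s'_gt /=; exact: lt_trans.
- by rewrite size_s'.
- have bmin t : t \in b :: s -> b <= t.
    rewrite inE => /predU1P[->//|ts].
    by move: pbs; rewrite path_sortedE; [move=> /andP[/allP/(_ t ts)/ltW]|exact: lt_trans].
  move=> t; rewrite inE => /predU1P[->|ts'].
    split => //; rewrite inE negb_or gt_eqF //=.
    by apply/negP => /bmin; rewrite leNgt cb.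
  have [t01 g't tbs] := s'P t ts'; split => //.
  rewrite inE negb_or tbs andbT gt_eqF //.
  exact: lt_trans ab (s'_gt _ ts').
- move=> t; rewrite inE => /predU1P[->//|/s'_gt /=]; exact: lt_trans.
Qed.

Lemma iter_rolle (F : nat -> R -> R) K s :
  (forall k (t : R), (k < K)%N -> 0 < t < 1 -> is_derive t (1 : R) (F k) (F k.+1 t)) ->
  sorted <%R s -> size s = K.+1 ->
  (forall a, a \in s -> 0 < a < 1 /\ F 0%N a = 0) ->
  exists2 xi, 0 < xi < 1 & F K xi = 0.
Proof.
elim: K F s => [|K IHK] F s dF ss sizes sP.
  by case: s sizes sP {ss} => // a [] // _ /(_ a (mem_head _ _))[]; exists a.
have [||||s' [ss' sizes' s'P _]] := @rolle_zeros (F 0%N) (F 1%N) s ss.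
- move=> a b /sP[a01 _] /sP[b01 _] ab.
  apply: derivable_within_continuous => t; rewrite in_itv /= => tab.
  have t01 : 0 < t < 1 by move: a01 b01 tab; lra.
  by have [] := dF 0%N t (ltn0Sn _) t01.
- by move=> a /sP[/andP[/ltW-> /ltW->]].
- by move=> t; apply: dF.
- by move=> a /sP[].
apply: (IHK (fun k => F k.+1) s') => //.
- by move=> k t kK; apply: dF.
- by rewrite sizes' sizes.
- by move=> a /s'P[].
Qed.

(** Counting zeros of [F 0] with multiplicity: the [K + 1] zeros, those in [d]
being double, give [K] distinct interior zeros of [F 1], to which the iterated
theorem applies.  Only the first step may touch the end points, where [F 0] is
merely continuous. *)
Lemma hermite_rolle (F : nat -> R -> R) K s d :
  (0 < K)%N ->
  {within `[0, 1], continuous (F 0%N)} ->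
  (forall k (t : R), (k < K)%N -> 0 < t < 1 -> is_derive t (1 : R) (F k) (F k.+1 t)) ->
  uniq s -> uniq d -> {subset d <= s} -> (size s + size d = K.+1)%N ->
  (forall a, a \in s -> 0 <= a <= 1 /\ F 0%N a = 0) ->
  (forall a, a \in d -> 0 < a < 1 /\ F 1%N a = 0) ->
  exists2 xi, 0 < xi < 1 & F K xi = 0.
Proof.
move=> K0 cF dF us ud ds sizesd sP dP.
case: K K0 dF sizesd => // K _ dF sizesd.
have mem_srt a : (a \in sort <=%R s) = (a \in s) by rewrite mem_sort.
have [|||||s' [ss' sizes' s'P _]] := @rolle_zeros (F 0%N) (F 1%N) (sort <=%R s).
- by rewrite sort_lt_sorted.
- move=> a b; rewrite !mem_srt => /sP[/andP[a0 _] _] /sP[/andP[_ b1] _] ab.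
  apply: continuous_subspaceW cF => t /=; rewrite !in_itv /=.
  by move=> /andP[at_ tb]; rewrite (le_trans a0) // (le_trans tb).
- by move=> a; rewrite mem_srt => /sP[].
- by move=> t; apply: dF.
- by move=> a; rewrite mem_srt => /sP[].
apply: (@iter_rolle (fun k => F k.+1) K (sort <=%R (s' ++ d))) => //.
- by move=> k t kK; apply: dF.
- rewrite sort_lt_sorted cat_uniq ud (lt_sorted_uniq ss') andbT /=.
  apply/hasPn => a /ds ads; apply/negP => /s'P[_ _].
  by rewrite mem_srt ads.
- rewrite size_sort size_cat sizes' size_sort.
  by move: sizesd (uniq_leq_size ud ds); move: (size s) (size d) => a b; lia.
- by move=> a; rewrite mem_sort mem_cat => /orP[/s'P[]|/dP[]].
Qed.

End Rolle.

Section HermiteInterpolation.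
Variable R : realType.
Variables (f : R -> R) (m : nat).
Hypothesis f_cont : {within `[0, 1], continuous f}.
Hypothesis f_derivable : derivable_upto m f.
Implicit Types (h : {poly R}) (z : seq R).

Definition nodal z : {poly R} := \prod_(a <- z) ('X - a%:P).

(** A node occurring twice in [z] also prescribes the derivative. *)
Definition hermite z h : Prop := forall a, a \in z ->
  h.[a] = f a /\ (count_mem a z = 2%N -> (h^`()).[a] = derive1n 1 f a).

(** Double nodes must be interior since [f] need not be differentiable at [0] and
[1]. *)
Definition hermite_nodes z : Prop := forall a, a \in z ->
  [/\ 0 <= a <= 1, (count_mem a z <= 2)%N & count_mem a z = 2%N -> 0 < a < 1].

Lemma size_undup_count2 z : (forall a, a \in z -> (count_mem a z <= 2)%N) ->
  (size (undup z) + size [seq a <- undup z | count_mem a z == 2%N])%N = size z.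
Proof.
move=> z2.
have -> : size z = (\sum_(a <- undup z) count_mem a z)%N.
  rewrite -sum1_size -big_undup_iterop_count; apply: eq_bigr => a _.
  by elim: (count_mem a z) => // -[|c] //= <-.
rewrite size_filter -sum1_count [in X in (_ + X)%N]big_mkcond -sum1_size -big_split /=.
rewrite !big_seq; apply: eq_bigr => a; rewrite mem_undup => az.
by move: (z2 a az); move: az; rewrite -has_pred1 has_count; case: count => [|[|[|]]].
Qed.

(** Rolle's theorem for [f - h], which has [k + 1] zeros. *)
Lemma hermite_derivn z h k : (0 < k <= m)%N -> hermite_nodes z ->
  hermite z h -> size z = k.+1 ->
  exists2 xi, 0 < xi < 1 & derive1n k f xi = (h^`(k)).[xi].
Proof.
move=> /andP[k0 km] zn hz sz.
pose F j (t : R) := derive1n j f t - (h^`(j)).[t].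
have [||||||||xi xi01 Fxi] := @hermite_rolle R F k (undup z)
  [seq a <- undup z | count_mem a z == 2%N] k0.
- move=> t; apply: continuousB; first exact: f_cont.
  by apply: continuous_subspaceT => ?; exact: continuous_horner.
- move=> j t jk t01.
  have dfj : is_derive t (1:R) (derive1n j f) (derive1n j.+1 f t).
    rewrite derive1nS derive1E; apply: DeriveDef => //.
    by apply: f_derivable => //; apply: leq_trans jk km.
  rewrite /F derivnS; exact: is_deriveB.
- exact: undup_uniq.
- by rewrite filter_uniq ?undup_uniq.
- by move=> a; rewrite mem_filter => /andP[].
- by rewrite size_undup_count2 // => a /zn[].
- move=> a; rewrite mem_undup => az; have [a01 _ _] := zn a az.
  by have [hfa _] := hz a az; rewrite /F derivn0 hfa subrr.
- move=> a; rewrite mem_filter mem_undup => /andP[/eqP c2 az].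
  have [_ _ /(_ c2) a01] := zn a az; have [_ /(_ c2) hfa] := hz a az.
  by rewrite /F derivn1 hfa subrr.
by exists xi => //; apply/eqP; rewrite -subr_eq0; apply/eqP.
Qed.

Lemma size_nodal z : size (nodal z) = (size z).+1.
Proof. exact: size_prod_XsubC. Qed.

Lemma nodal_rcons z a : nodal (rcons z a) = nodal z * ('X - a%:P).
Proof. by rewrite /nodal big_rcons. Qed.

Lemma root_nodal z a : root (nodal z) a = (a \in z).
Proof. exact: root_prod_XsubC. Qed.

Lemma deriv_nodal_eq0 z a : (1 < count_mem a z)%N -> ((nodal z)^`()).[a] = 0.
Proof.
elim/last_ind: z => // z b IHz; rewrite -cats1 count_cat /= addn0 cats1 => az.
rewrite nodal_rcons derivM derivXsubC mulr1 !hornerE.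
have -> : (nodal z).[a] = 0.
  apply/eqP; rewrite -/(root _ a) root_nodal -has_pred1 has_count.
  by move: az (leq_b1 (b == a)); move: (count _ z) (nat_of_bool _) => c e; lia.
rewrite addr0; case: (eqVneq b a) az => [->|_ az]; first by rewrite subrr mulr0.
by rewrite IHz ?mul0r //; move: az; rewrite addn0.
Qed.

Lemma deriv_nodal_neq0 z a : count_mem a z = 1%N -> ((nodal z)^`()).[a] != 0.
Proof.
elim/last_ind: z => // z b IHz; rewrite -cats1 count_cat /= addn0 cats1 => az.
rewrite nodal_rcons derivM derivXsubC mulr1 !hornerE.
case: (eqVneq b a) az => [-> az|ba az].
  rewrite subrr mulr0 add0r -/(root _ a) root_nodal -has_pred1 has_count.
  by move: az; rewrite addn1 => -[->].
have -> : (nodal z).[a] = 0.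
  apply/eqP; rewrite -/(root _ a) root_nodal -has_pred1 has_count.
  by move: az; rewrite addn0 => ->.
rewrite addr0 mulf_neq0 ?IHz //; first by move: az; rewrite addn0.
by rewrite subr_eq0 eq_sym.
Qed.

Lemma derivn_nodal z t : ((nodal z)^`(size z)).[t] = (size z)`!%:R.
Proof.
have sz : (size ((nodal z)^`(size z))%R <= 1)%N.
  apply/leq_sizeP => j j1; rewrite coef_derivn nth_default ?mul0rn //.
  by rewrite size_nodal -(addn1 (size z)) leq_add2l.
rewrite (size1_polyC sz) hornerC coef_derivn addn0 ffactnn.
have : lead_coef (nodal z) = 1 by apply/eqP/monic_prod_XsubC.
by rewrite lead_coefE size_nodal /= => ->.
Qed.

(** Adding a multiple of the nodal polynomial keeps the conditions at [z] and can
meet one more.  The multiple is a divided difference of [f], whence its mean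
value form. *)
Lemma hermite_step z a h : (size z <= m)%N -> hermite_nodes (rcons z a) ->
  (size h <= size z)%N -> hermite z h ->
  exists c, hermite (rcons z a) (h + c *: nodal z) /\
    ((0 < size z)%N -> exists2 xi, 0 < xi < 1 &
       derive1n (size z) f xi = c * (size z)`!%:R).
Proof.
move=> zm zn sh hz.
have cnt b : count_mem b (rcons z a) = (count_mem b z + (a == b))%N.
  by rewrite -cats1 count_cat /= addn0.
have cz b : (0 < count_mem b z)%N = (b \in z) by rewrite -has_count has_pred1.
suff [c hc] : exists c, hermite (rcons z a) (h + c *: nodal z).
  exists c; split => // z0.
  have [|//|//||xi xi01 fxi] := @hermite_derivn (rcons z a) (h + c *: nodal z) (size z).
  - by rewrite z0.
  - by rewrite size_rcons.
  exists xi => //; rewrite fxi derivnD derivnZ hornerD hornerZ derivn_nodal.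
  by rewrite derivn_poly0 // horner0 add0r.
have [|az] := boolP (a \in z); last first.
  exists ((f a - h.[a]) / (nodal z).[a]) => b; rewrite mem_rcons inE.
  have na : (nodal z).[a] != 0 by rewrite -/(root _ a) root_nodal.
  case: (eqVneq b a) => [-> _|ba /= bz].
    rewrite !hornerE divfK // subrKC; split => // c2.
    by move: c2 az; rewrite cnt eqxx -cz; lia.
  have [hfb h'fb] := hz b bz.
  have nb : (nodal z).[b] = 0 by apply/eqP; rewrite -/(root _ b) root_nodal.
  rewrite !hornerE nb mulr0 addr0; split => //.
  rewrite cnt [a == b]eq_sym (negPf ba) addn0 => c2.
  by rewrite derivD derivZ !hornerE (@deriv_nodal_eq0 z b) ?c2 // mulr0 addr0 h'fb.
move=> az; have ca1 : count_mem a z = 1%N.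
  have [] := zn a; first by rewrite mem_rcons mem_head.
  by rewrite cnt eqxx => _; move: az; rewrite -cz; lia.
have na := deriv_nodal_neq0 ca1.
exists ((derive1n 1 f a - (h^`()).[a]) / ((nodal z)^`()).[a]) => b.
rewrite mem_rcons inE => bz'; have bz : b \in z by case/predU1P: bz' => [->|].
have [hfb h'fb] := hz b bz.
have nb : (nodal z).[b] = 0 by apply/eqP; rewrite -/(root _ b) root_nodal.
split; first by rewrite !hornerE nb mulr0 addr0.
rewrite cnt; case: (eqVneq a b) => [<- _|ba].
  by rewrite derivD derivZ !hornerE divfK // subrKC.
rewrite addn0 => c2.
by rewrite derivD derivZ !hornerE (@deriv_nodal_eq0 z b) ?c2 // mulr0 addr0 h'fb.
Qed.

Lemma hermite_nodes_rcons z a : hermite_nodes (rcons z a) -> hermite_nodes z.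
Proof.
move=> zn b bz; have [|b01] := zn b; first by rewrite mem_rcons inE bz orbT.
rewrite -cats1 count_cat /= addn0 => c2 c2'; split => //; first lia.
by move=> e; apply: c2'; lia.
Qed.

(** Add [u] to the nodes: the new interpolant agrees with [f] at [u]. *)
Lemma hermite_remainder z h u : (0 < size z <= m)%N -> hermite_nodes z ->
  (size h <= size z)%N -> hermite z h -> 0 <= u <= 1 -> u \notin z ->
  exists2 xi, 0 < xi < 1 &
    f u - h.[u] = derive1n (size z) f xi / (size z)`!%:R * (nodal z).[u].
Proof.
move=> /andP[z0 zm] zn sh hz u01 uz.
have zun : hermite_nodes (rcons z u).
  move=> b; rewrite mem_rcons inE -cats1 count_cat /= addn0 => /predU1P[->|bz].
    by rewrite eqxx (count_memPn uz).
  have [b01 c2 c2'] := zn b bz; rewrite (_ : (u == b) = false) ?addn0 //.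
  by apply: contraNF uz => /eqP->.
have [c [hc /(_ z0)[xi xi01 cE]]] := hermite_step zm zun sh hz.
exists xi => //; rewrite cE mulfK ?pnatr_eq0 -?lt0n ?fact_gt0 //.
have [] := hc u; first by rewrite mem_rcons mem_head.
by rewrite hornerD hornerZ => <- _; rewrite addrC addKr.
Qed.

Lemma size_newton_sum z (c : nat -> R) :
  (size (\sum_(i < size z) c i *: nodal (take i z))%R <= size z)%N.
Proof.
rewrite (leq_trans (size_sum _ _ _)) //; apply/bigmax_leqP => i _.
by rewrite (leq_trans (size_scale_leq _ _)) // size_nodal size_takel // ltnW.
Qed.

(** Newton's form of the interpolant. *)
Lemma newton_hermite z : (size z <= m.+1)%N -> hermite_nodes z ->
  exists h (c : nat -> R), [/\ h = \sum_(i < size z) c i *: nodal (take i z), hermite z h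
    & forall i, (0 < i < size z)%N -> exists2 xi, 0 < xi < 1 &
        derive1n i f xi = c i * i`!%:R].
Proof.
elim/last_ind: z => [|z a IHz].
  by exists 0, (fun=> 0); split => [|//|i]; rewrite ?big_ord0 ?ltn0 ?andbF.
rewrite size_rcons => zm zn.
have [h [c [hE hz cP]]] := IHz (ltnW zm) (hermite_nodes_rcons zn).
have sh : (size h <= size z)%N by rewrite hE size_newton_sum.
have [d [hd dP]] := hermite_step zm zn sh hz.
exists (h + d *: nodal z), (fun i => if i == size z then d else c i); split => //.
  rewrite big_ord_recr /= eqxx -cats1 take_size_cat // hE; congr (_ + _).
  apply: eq_bigr => i _; rewrite ltn_eqF ?ltn_ord //.
  by rewrite takel_cat // ltnW.
move=> i /andP[i0]; rewrite ltnS leq_eqVlt => /predU1P[iz|iz].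
  by rewrite iz eqxx; apply: dP; rewrite -iz.
by rewrite ltn_eqF //; apply: cP; rewrite i0.
Qed.

End HermiteInterpolation.

(** * Energies and potentials of designs *)

(** Polynomials of all degrees below [k] span. *)
Lemma eq_functional_span (R : realFieldType) (S T : {scalar {poly R}})
    (Q : nat -> {poly R}) k (q : {poly R}) :
  (forall l, (l < k)%N -> size (Q l) = l.+1) ->
  (forall l, (l < k)%N -> S (Q l) = T (Q l)) ->
  (size q <= k)%N -> S q = T q.
Proof.
elim: k q => [|k IHk] q sQ ST.
  by rewrite leqn0 size_poly_eq0 => /eqP->; rewrite !linear0.
move=> sq; rewrite -(subrK ((q`_k / lead_coef (Q k)) *: Q k) q).
rewrite linearD [in RHS]linearD /= !functionalZ ST //; congr (_ + _); apply: IHk.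
- by move=> l lk; apply/sQ/ltnW.
- by move=> l lk; apply/ST/ltnW.
- by apply: size_sub_leading => //; apply: sQ.
Qed.

Section Designs.
Variables (R : realType) (n : nat).
Hypothesis n_ge2 : (2 <= n)%N.
Local Notation L := (sphere_functional R n_ge2).
Local Notation P := (gegenbauer R n).
Implicit Types (q : {poly R}).

(** The mean over the sphere of [x |-> q ((x . y) ^ 2)], for any unit vector [y]. *)
Definition sphere_mean q : R := L (q \Po 'X^2) / L 1.

Lemma sphere_mean_is_scalar : scalar sphere_mean.
Proof.
move=> a p q; rewrite /sphere_mean comp_polyD comp_polyZ linearD /= functionalZ.
by rewrite mulrDl mulrA.
Qed.

HB.instance Definition _ := GRing.isLinear.Build R {poly R} R *%R
  sphere_mean sphere_mean_is_scalar.

Section Code.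
Variables (M : nat) (x : 'I_M -> 'rV[R]_n) (w : 'I_M -> R).

Definition energy_functional q : R := energy (horner q) x w.

Lemma energy_functional_is_scalar : scalar energy_functional.
Proof.
move=> a p q; rewrite /energy_functional /energy mulr_sumr -big_split /=.
apply: eq_bigr => i _; rewrite mulr_sumr -big_split /=.
by apply: eq_bigr => j _; rewrite hornerD hornerZ mulrDr [in RHS]mulrCA.
Qed.

HB.instance Definition _ := GRing.isLinear.Build R {poly R} R *%R
  energy_functional energy_functional_is_scalar.

Definition potential_functional (y : 'rV[R]_n) q : R :=
  \sum_(j < M) w j * q.[dotp y (x j) ^+ 2].

Lemma potential_functional_is_scalar y : scalar (potential_functional y).
Proof.
move=> a p q; rewrite /potential_functional mulr_sumr -big_split /=.
by apply: eq_bigr => j _; rewrite hornerD hornerZ mulrDr [in RHS]mulrCA.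
Qed.

HB.instance Definition _ y := GRing.isLinear.Build R {poly R} R *%R
  (potential_functional y) (potential_functional_is_scalar y).

End Code.

Lemma half_gegenbauer_even k t : (half_gegenbauer R n false k).[t ^+ 2] = (P (2 * k)).[t].
Proof.
have := gegenbauer_half R n_ge2 false k; rewrite addn0 expr0 mul1r => ->.
by rewrite horner_comp hornerXn.
Qed.

Lemma sphere_functional1_gt0 : 0 < L 1.
Proof.
apply: sphere_functional_gt0; first exact: oner_neq0.
by move=> t _; rewrite hornerC ler01.
Qed.

Lemma sphere_mean_half_gegenbauer k :
  sphere_mean (half_gegenbauer R n false k) = (k == 0)%:R.
Proof.
have := gegenbauer_half R n_ge2 false k; rewrite addn0 expr0 mul1r.
rewrite /sphere_mean => <-; case: k => [|k].
  by rewrite muln0 (gegenbauer0 R n_ge2) divff // gt_eqF // sphere_functional1_gt0.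
have [_ _ /(_ 1)] := gegenbauerP R n_ge2 (2 * k.+1).
by rewrite mulr1 => -> //; [rewrite mul0r|rewrite size_poly1; lia].
Qed.

Lemma half_gegenbauer0 t : (half_gegenbauer R n false 0).[t ^+ 2] = 1.
Proof. by rewrite half_gegenbauer_even muln0 (gegenbauer0 R n_ge2) hornerC. Qed.

Lemma energy_half_gegenbauer0 M (x : 'I_M -> 'rV[R]_n) (w : 'I_M -> R) :
  \sum_i w i = 1 -> energy_functional x w (half_gegenbauer R n false 0) = 1.
Proof.
move=> w1; rewrite /energy_functional /energy.
under eq_bigr => i _ do under eq_bigr => j _ do rewrite half_gegenbauer0 mulr1.
under eq_bigr => i _ do rewrite -mulr_sumr w1 mulr1.
by [].
Qed.

(** Both sides are linear in [q] and agree on the even Gegenbauer polynomials,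
written in the variable [t ^ 2]. *)
Lemma design_energy M k (x : 'I_M -> 'rV[R]_n) (w : 'I_M -> R) q :
  weighted_design k x w -> (size q <= k.+1)%N ->
  energy (horner q) x w = sphere_mean q.
Proof.
move=> [[_ _ _ w1] xP] sq.
apply: (@eq_functional_span _ (energy_functional x w) sphere_mean
  (half_gegenbauer R n false) k.+1) => //.
  by move=> l _; apply: size_half_gegenbauer.
move=> [|l] lk; first by rewrite /= energy_half_gegenbauer0 // sphere_mean_half_gegenbauer.
rewrite /= sphere_mean_half_gegenbauer /= -[RHS](xP l.+1) //.
apply: eq_bigr => i _; apply: eq_bigr => j _.
by rewrite half_gegenbauer_even.
Qed.

Lemma energy_design M k (x : 'I_M -> 'rV[R]_n) (w : 'I_M -> R) :
  weighted_code x w ->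
  (forall q, (size q <= k.+1)%N -> energy (horner q) x w = sphere_mean q) ->
  weighted_design k x w.
Proof.
move=> xw eP; split => // l /andP[l0 lk].
have := eP (half_gegenbauer R n false l).
rewrite size_half_gegenbauer // ltnS lk sphere_mean_half_gegenbauer eqn0Ngt l0 /=.
move=> /(_ isT) e0; rewrite -[RHS]e0; apply: eq_bigr => i _; apply: eq_bigr => j _.
by rewrite half_gegenbauer_even.
Qed.

(** The design condition for [P_(2 l)] says that the squared norm of the weighted
sum of the feature vectors is zero, so the potential vanishes at every point. *)
Lemma design_potential M k (x : 'I_M -> 'rV[R]_n) (w : 'I_M -> R) y q :
  weighted_design k x w -> dotp y y = 1 -> (size q <= k.+1)%N ->
  \sum_(j < M) w j * q.[dotp y (x j) ^+ 2] = sphere_mean q.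
Proof.
move=> [[x1 _ _ w1] xP] y1 sq.
apply: (@eq_functional_span _ (potential_functional x w y) sphere_mean
  (half_gegenbauer R n false) k.+1) => //.
  by move=> l _; apply: size_half_gegenbauer.
move=> [|l] lk; rewrite /= sphere_mean_half_gegenbauer /= /potential_functional.
  by under eq_bigr => j _ do rewrite half_gegenbauer0 mulr1.
under eq_bigr => j _ do rewrite half_gegenbauer_even.
have [T [phi phiP]] := gram_gegenbauer R n_ge2 (2 * l.+1).
pose B t := \sum_j w j * phi (x j) t.
have B0 t : B t = 0.
  have : \sum_t B t ^+ 2 = 0.
    rewrite -[RHS](xP l.+1) //.
    under eq_bigr => s _ do rewrite expr2 big_distrlr /=.
    rewrite exchange_big; apply: eq_bigr => i _; rewrite exchange_big; apply: eq_bigr => j _.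
    by rewrite phiP // mulr_sumr; apply: eq_bigr => s _; rewrite mulrACA.
  move/eqP; rewrite psumr_eq0 => [/allP/(_ t)|s _]; last exact: sqr_ge0.
  by rewrite mem_index_enum => /(_ isT) /=; rewrite sqrf_eq0 => /eqP.
under eq_bigr => j _ do rewrite phiP // mulr_sumr.
rewrite exchange_big big1 // => t _.
under eq_bigr => j _ do rewrite mulrCA.
by rewrite -mulr_sumr -/(B t) B0 mulr0.
Qed.

(** Let [A] and [B] be the weighted sums of the feature vectors of the code and of
the design.  Then [|A - B|^2 >= 0], where [<A, B>] and [|B|^2] are both the
mean of [q]. *)
Lemma gram_energy_ge M N k (x : 'I_M -> 'rV[R]_n) (w : 'I_M -> R)
    (y : 'I_N -> 'rV[R]_n) (v : 'I_N -> R) q :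
  weighted_design k y v -> (size q <= k.+1)%N ->
  gram_kernel (fun a b : 'rV[R]_n => q.[dotp a b ^+ 2]) ->
  weighted_code x w ->
  sphere_mean q <= energy (horner q) x w.
Proof.
move=> yv sq [T [phi phiP]] [x1 _ _ w1].
have [[y1 _ _ _] _] := yv.
pose A t := \sum_i w i * phi (x i) t; pose B t := \sum_j v j * phi (y j) t.
have cross K (z : 'I_K -> 'rV[R]_n) (u : 'I_K -> R) K' (z' : 'I_K' -> 'rV[R]_n) (u' : 'I_K' -> R) :
    (forall i, dotp (z i) (z i) = 1) -> (forall i, dotp (z' i) (z' i) = 1) ->
    \sum_t (\sum_i u i * phi (z i) t) * (\sum_j u' j * phi (z' j) t) =
    \sum_i \sum_j u i * u' j * q.[dotp (z i) (z' j) ^+ 2].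
  move=> z1 z1'; under eq_bigr => s _ do rewrite big_distrlr /=.
  rewrite exchange_big; apply: eq_bigr => i _; rewrite exchange_big; apply: eq_bigr => j _.
  by rewrite phiP // mulr_sumr; apply: eq_bigr => s _; rewrite mulrACA.
have AA : \sum_t A t * A t = energy (horner q) x w by apply: cross.
have BB : \sum_t B t * B t = sphere_mean q by rewrite -(design_energy yv sq); apply: cross.
have AB : \sum_t A t * B t = sphere_mean q.
  rewrite [LHS]cross // (eq_bigr (fun i => w i * sphere_mean q)).
    by rewrite -mulr_suml w1 mul1r.
  move=> i _; rewrite -(design_potential yv (x1 i) sq) mulr_sumr.
  by apply: eq_bigr => j _; rewrite mulrA.
have : 0 <= \sum_t (A t - B t) ^+ 2 by apply: sumr_ge0 => t _; exact: sqr_ge0.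
rewrite (eq_bigr (fun t => A t * A t - 2 * (A t * B t) + B t * B t)); last first.
  by move=> t _; ring.
rewrite big_split /= sumrB -mulr_sumr AA AB BB; lra.
Qed.

End Designs.

(** * Interpolation nodes of a symmetric set *)

Section DoubledNodes.
Variable R : realType.
Implicit Types s : seq R.

Definition doubled s : seq R := flatten [seq [:: b; b] | b <- s].

Lemma size_doubled s : size (doubled s) = (2 * size s)%N.
Proof. by elim: s => //= b s ->; rewrite mulnS. Qed.

Lemma mem_doubled s b : (b \in doubled s) = (b \in s).
Proof. by elim: s => //= a s IHs; rewrite !inE IHs orbA orbb. Qed.

Lemma count_doubled s b : count_mem b (doubled s) = (2 * count_mem b s)%N.
Proof. by elim: s => //= a s ->; lia. Qed.

Lemma nodal_cons a s : nodal (a :: s) = ('X - a%:P) * nodal s.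
Proof. by rewrite /nodal big_cons. Qed.

(** For nodes in the order [b_1, b_1, b_2, b_2, ...] Newton polynomials are
products of two products over distinct nodes. *)
Lemma nodal_take_doubled s i : nodal (take i (doubled s)) =
  nodal (take i./2 s) * nodal (take (uphalf i) s).
Proof.
elim: s i => [|b s IHs] i; first by rewrite !take_oversize // /nodal big_nil mulr1.
case: i => [|[|i]]; first by rewrite !take0 /nodal big_nil mulr1.
  by rewrite /= !take0 /nodal big_nil !big_cons big_nil mul1r.
by rewrite /= !nodal_cons IHs; ring.
Qed.

End DoubledNodes.

Section SymmetricSet.
Variables (R : realType) (A : seq R).
Hypothesis A_incr : sorted <%R A.
Hypothesis A_bound : forall a, a \in A -> - 1 < a < 1.
Hypothesis A_sym : forall a, a \in A -> - a \in A.

Definition pos_squares : seq R := [seq a ^+ 2 | a <- A & 0 < a].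

Let uniqA : uniq A := lt_sorted_uniq A_incr.

Lemma pos_squares_sorted : sorted <%R pos_squares.
Proof.
rewrite sorted_map; apply: (@sub_in_sorted _ (fun a => 0 < a) <%R).
- by move=> a b /= a0 b0 ab; rewrite ltr_pXn2r // nnegrE ltW.
- by apply/allP => a; rewrite mem_filter => /andP[].
- exact: lt_sorted_filter.
Qed.

(** Negation exchanges the positive and negative elements. *)
Lemma size_symmetric : size A = (2 * size pos_squares + (0%R \in A))%N.
Proof.
have cN : count (fun a => a < 0) A = count (fun a => 0 < a) A.
  rewrite -!size_filter -(size_map -%R); apply/perm_size/uniq_perm.
  - by rewrite map_inj_uniq ?filter_uniq //; exact: oppr_inj.
  - by rewrite filter_uniq.
  move=> a; rewrite mem_filter; apply/mapP/andP => [[b]|[a0 aA]].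
    by rewrite mem_filter => /andP[b0 bA] ->; rewrite oppr_gt0; split; [|exact: A_sym].
  by exists (- a); rewrite ?opprK // mem_filter oppr_lt0 a0 A_sym.
have cC : count (predC (fun a => 0 < a)) A = (count (fun a => (a < 0)%R) A + (0%R \in A))%N.
  rewrite -(count_uniq_mem 0 uniqA) -count_predUI [X in (_ + X)%N](_ : _ = 0%N).
    by rewrite addn0; apply: eq_count => a /=; rewrite -leNgt le_eqVlt orbC.
  by apply/eqP; rewrite -leqn0 leqNgt -has_count; apply/hasPn => a _ /=; case: ltgtP.
by rewrite size_map size_filter -(count_predC (fun a => 0 < a)) cC cN mul2n -addnn addnA.
Qed.

Lemma sqr_mem_pos_squares (t : R) :
  (t ^+ 2 \in pos_squares) = (t \in A) && (t != 0).
Proof.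
apply/mapP/andP => [[a]|[tA t0]].
  rewrite mem_filter => /andP[a0 aA] /eqP; rewrite eqf_sqr => /orP[]/eqP->.
    by rewrite gt_eqF.
  by rewrite oppr_eq0 gt_eqF // A_sym.
have [t_gt0|t_le0] := ltP 0 t; first by exists t; rewrite // mem_filter t_gt0.
exists (- t); rewrite ?sqrrN // mem_filter A_sym // oppr_gt0 lt_neqAle t0 t_le0 //.
Qed.

Lemma pos_squares_bound b : b \in pos_squares -> 0 < b < 1.
Proof.
move=> /mapP[a]; rewrite mem_filter => /andP[a0 /A_bound/andP[_ a1]] ->.
by rewrite exprn_gt0 // exprn_ilt1 // ltW.
Qed.

End SymmetricSet.

Section HermiteNodes.
Variables (R : realType) (A : seq R).
Hypothesis A_incr : sorted <%R A.
Hypothesis A_bound : forall a, a \in A -> - 1 < a < 1.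
Hypothesis A_sym : forall a, a \in A -> - a \in A.
Local Notation eps := (0%R \in A).
Local Notation B := (pos_squares A).

(** The order of the nodes matters for Newton polynomials: [0] comes first, since
its factor [u = t * t] splits evenly, and then the positive squares increase. *)
Definition square_nodes : seq R := nseq eps 0 ++ doubled B.

Lemma size_square_nodes : size square_nodes = size A.
Proof. by rewrite size_cat size_nseq size_doubled (size_symmetric A_incr A_sym) addnC. Qed.

Lemma pos_squares_neq0 : 0 \notin B.
Proof. by apply/negP => /(pos_squares_bound A_bound); rewrite ltxx. Qed.

Lemma sqr_mem_square_nodes t : (t ^+ 2 \in square_nodes) = (t \in A).
Proof.
rewrite mem_cat mem_doubled (sqr_mem_pos_squares A_sym) mem_nseq.
case: (eqVneq t 0) => [->|t0]; first by rewrite expr0n /= eqxx andbF orbF lt0b andbT.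
by rewrite sqrf_eq0 (negPf t0) !andbT andbF.
Qed.

Lemma square_nodes_hermite : hermite_nodes square_nodes.
Proof.
move=> b; rewrite mem_cat mem_nseq mem_doubled => bz.
have cB : (count_mem b B <= 1)%N.
  by rewrite (count_uniq_mem _ (lt_sorted_uniq (pos_squares_sorted A_incr))) leq_b1.
rewrite /square_nodes count_cat count_doubled count_nseq /=.
case: (eqVneq b 0) bz cB => [->|b0] bz cB.
  have -> : count_mem 0 B = 0%N by apply/count_memPn; exact: pos_squares_neq0.
  by split; rewrite ?lexx ?ler01 //; case: (_ \in _).
have /(pos_squares_bound A_bound) b01 : b \in B by move: bz; rewrite andbF.
rewrite mul0n add0n; split => //; first by case/andP: b01 => /ltW-> /ltW->.
by move: cB; case: (count _ _) => [|[|]].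
Qed.

Lemma nodal_take_square_nodes i : nodal (take i square_nodes) =
  if eps && (i == 0)%N then 1 else
  'X^eps * (nodal (take (i - eps)./2 B) * nodal (take (uphalf (i - eps)) B)).
Proof.
rewrite /square_nodes; case: eps => /=; last by rewrite expr0 mul1r subn0 nodal_take_doubled.
case: i => [|i] /=; first by rewrite /nodal big_nil.
by rewrite nodal_cons subr0 expr1 subn1 /= nodal_take_doubled.
Qed.

Lemma nodal_square_nodes_ge0 u : 0 <= u -> 0 <= (nodal square_nodes).[u].
Proof.
move=> u0; have := nodal_take_square_nodes (size square_nodes); rewrite take_size => ->.
have E : (size square_nodes - eps = 2 * size B)%N.
  by rewrite size_square_nodes (size_symmetric A_incr A_sym) addnK.
case: ifP => _; first by rewrite hornerC ler01.
rewrite E mul2n doubleK uphalf_double take_size !hornerM hornerXn.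
by rewrite mulr_ge0 ?exprn_ge0 // -expr2 sqr_ge0.
Qed.

End HermiteNodes.

(** * The quadrature formula of a design with few inner products *)

Section SharpDesign.
Variables (R : realType) (n m N : nat).
Hypotheses (n_ge2 : (2 <= n)%N) (m_gt0 : (0 < m)%N) (N_gt0 : (0 < N)%N).
Variable A : seq R.
Hypothesis A_incr : sorted <%R A.
Hypothesis A_bound : forall a, a \in A -> - 1 < a < 1.
Hypothesis A_sym : forall a, a \in A -> - a \in A.
Hypothesis size_A : size A = m.
Variable xs : 'I_N -> 'rV[R]_n.
Hypothesis xs_design : weighted_design m.-1 xs (fun=> N%:R^-1).
Hypothesis xs_dotp : forall i j, i != j -> dotp (xs i) (xs j) \in A.
Implicit Types (p q : {poly R}).
Local Notation eps := (0%R \in A).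
Local Notation B := (pos_squares A).
Local Notation L := (sphere_functional R n_ge2).
Local Notation P := (gegenbauer R n).
Local Notation H := (half_gegenbauer R n eps).
Local Notation mean := (sphere_mean n_ge2).
Local Notation u i j := (dotp (xs i) (xs j) ^+ 2).

Let mE : m = (2 * size B + eps)%N.
Proof. by rewrite -size_A (size_symmetric A_incr A_sym). Qed.

(** The end point [1] comes from the diagonal of the energy of the design. *)
Definition lobatto_nodes : seq R := rcons B 1.

(** [N^-2] times the number of pairs with a given square of inner product, times
the factor [b ^ e] by which the quadrature formula is multiplied. *)
Definition lobatto_weight (b : R) : R := if b == 1 then N%:R^-1 else
  b ^+ eps * (N%:R^-1 * N%:R^-1 * \sum_i \sum_(j | j != i) (u i j == b)%:R).

Local Notation S := (discrete_functional lobatto_nodes lobatto_weight).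

Lemma lobatto_nodes_sorted : sorted <%R lobatto_nodes.
Proof.
rewrite sorted_pairwise; last exact: lt_trans.
rewrite pairwise_rcons -(sorted_pairwise lt_trans) pos_squares_sorted // andbT.
by apply/allP => b /(pos_squares_bound A_bound)/andP[].
Qed.

Lemma offdiag_node_expansion q i j : j != i ->
  ('X^eps * q).[u i j] = \sum_(b <- B) (u i j == b)%:R * ('X^eps * q).[b].
Proof.
move=> ji; have tA : dotp (xs i) (xs j) \in A by apply: xs_dotp; rewrite eq_sym.
have uB := lt_sorted_uniq (pos_squares_sorted A_incr).
have [uin|uout] := boolP (u i j \in B).
  rewrite (bigD1_seq _ uin uB) /= eqxx mul1r big1 ?addr0 // => b.
  by rewrite eq_sym => /negPf->; rewrite mul0r.
have t0 : dotp (xs i) (xs j) = 0.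
  by apply/eqP; move: uout; rewrite (sqr_mem_pos_squares A_sym) tA /= negbK.
rewrite t0 expr0n /= hornerM hornerXn; move: tA; rewrite t0 => ->.
rewrite expr1 mul0r big_seq big1 // => b /(pos_squares_bound A_bound)/andP[b0 _].
by rewrite lt_eqF // mul0r.
Qed.

(** The energy of the design for the polynomial ['X^e * q], grouped by values of
the squared inner products.  If [0] is such a value then [e = 1] and it does
not contribute. *)
Lemma lobatto_quadrature q : (size q + eps <= m)%N -> S q = mean ('X^eps * q).
Proof.
move=> sq.
have sXq : (size ('X^eps * q)%R <= m.-1.+1)%N.
  rewrite prednK // (leq_trans (size_polyMleq _ _)) // size_polyXn addSn /= addnC //.
rewrite -(design_energy n_ge2 xs_design sXq) /discrete_functional big_rcons /=.
have [[xs1 _ _ _] _] := xs_design.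
have N0 : N%:R != 0 :> R by rewrite pnatr_eq0 -lt0n.
have diag i : N%:R^-1 * N%:R^-1 * ('X^eps * q).[u i i] = N%:R^-1 * N%:R^-1 * q.[1].
  by rewrite xs1 expr1n hornerM hornerXn expr1n mul1r.
rewrite /energy; under [RHS]eq_bigr => i _ do rewrite (bigD1 i) //= diag.
rewrite big_split /= addrC; congr (_ + _).
  rewrite sumr_const card_ord /lobatto_weight eqxx -mulr_natr.
  by field.
rewrite big_seq (eq_bigr (fun b => \sum_i \sum_(j | j != i)
   N%:R^-1 * N%:R^-1 * ((u i j == b)%:R * ('X^eps * q).[b]))); last first.
  move=> b bB; rewrite /lobatto_weight lt_eqF; last first.
    by have /andP[] := pos_squares_bound A_bound bB.
  rewrite /=; set c := \sum_(i < N) \sum_(j < N | j != i) (u i j == b)%:R.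
  rewrite (_ : _ * q.[b] = N%:R^-1 * N%:R^-1 * (b ^+ eps * q.[b]) * c); last by ring.
  rewrite /c mulr_sumr; apply: eq_bigr => i _; rewrite mulr_sumr; apply: eq_bigr => j _.
  by rewrite hornerM hornerXn; ring.
rewrite -big_seq exchange_big; apply: eq_bigr => i _.
rewrite exchange_big; apply: eq_bigr => j ji.
by rewrite -mulr_sumr -offdiag_node_expansion.
Qed.

(** Test the formula on [(1 - u) * g ^ 2], where [g] vanishes at the other
positive squares: its integral is positive, and only the node [b] survives.
In particular every positive square of [A] is attained. *)
Lemma lobatto_weight_gt0 b : b \in lobatto_nodes -> 0 < lobatto_weight b.
Proof.
rewrite mem_rcons inE => /predU1P[->|bB].
  by rewrite /lobatto_weight eqxx invr_gt0 ltr0n.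
have uB := lt_sorted_uniq (pos_squares_sorted A_incr).
pose g := nodal (rem b B); pose q := (1 - 'X) * (g * g).
have sg : size g = size B by rewrite size_nodal size_rem // prednK //; case: (B) bB.
have g0 : g != 0 by rewrite -size_poly_gt0 sg; case: (B) bB.
have sq : (size q + eps <= m)%N.
  rewrite mE leq_add2r (leq_trans (size_polyMleq _ _)) //.
  rewrite -opprB size_polyN size_XsubC /= add1n size_mul // sg.
  have : (0 < size B)%N by case: (B) bB.
  by move: (size B) => k; lia.
have : 0 < S q.
  rewrite lobatto_quadrature // /sphere_mean divr_gt0 ?sphere_functional1_gt0 //.
  apply: sphere_functional_gt0.
    rewrite comp_poly_eq0 ?size_polyXn // !mulf_neq0 // -?size_poly_gt0 ?size_polyXn //.
    by rewrite -opprB size_polyN size_XsubC.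
  move=> t t1; rewrite horner_comp hornerXn /q !hornerM hornerXn mulr_ge0 //.
    by rewrite exprn_ge0 ?sqr_ge0.
  rewrite mulr_ge0 //; last by rewrite -expr2 sqr_ge0.
  by rewrite !hornerE subr_ge0; nra.
rewrite /discrete_functional big_rcons /=.
have -> : q.[1] = 0 by rewrite /q hornerM hornerD hornerN hornerC hornerX subrr mul0r.
rewrite mulr0 addr0.
rewrite (bigD1_seq b) //= big_seq_cond big1 ?addr0; last first.
  move=> c /andP[cB cb]; rewrite /q !hornerM (_ : g.[c] = 0) ?mul0r ?mulr0 //.
  by apply/eqP; rewrite -/(root _ c) root_nodal mem_rem_uniq // inE cb.
rewrite pmulr_lgt0 // /q !hornerM; have /andP[b0 b1] := pos_squares_bound A_bound bB.
rewrite mulr_gt0 //; first by rewrite !hornerE subr_gt0.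
rewrite -expr2 exprn_even_gt0 //= -/(root g b) root_nodal.
by rewrite mem_rem_uniq // inE eqxx.
Qed.

Lemma comp_sqr_size q k : (size q <= k)%N -> (size (q \Po 'X^2)%R <= (2 * k).-1)%N.
Proof.
move=> sq; have [->|q0] := eqVneq q 0; first by rewrite comp_poly0 size_poly0.
have c0 : q \Po 'X^2 != 0 by rewrite comp_poly_eq0 ?size_polyXn.
have := size_comp_poly q 'X^2; rewrite size_polyXn /=.
move: sq q0 c0; rewrite -!size_poly_gt0.
by move: (size (q \Po 'X^2)) (size q) => a b; lia.
Qed.

(** Orthogonality for the discrete measure is orthogonality of [P_(2 k + e)] to
[t ^ e * q (t ^ 2)], because the quadrature formula is exact for [H_k * q]. *)
Lemma orth_half_gegenbauer k : (k <= size B)%N -> orth_poly S k (H k).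
Proof.
move=> kB; split.
- exact: size_half_gegenbauer.
- exact: lead_coef_half_gegenbauer.
move=> q sq.
rewrite /= lobatto_quadrature; last first.
  rewrite [X in (_ <= X)%N]mE leq_add2r.
  rewrite (leq_trans (size_polyMleq _ _)) // size_half_gegenbauer //.
  by move: sq kB; move: (size q) (size B) => a b; lia.
rewrite /sphere_mean !comp_polyM comp_Xn_poly.
have -> : 'X^2 ^+ eps * ((H k \Po 'X^2) * (q \Po 'X^2)) =
    P (2 * k + eps) * ('X^eps * (q \Po 'X^2)).
  by rewrite (gegenbauer_half R n_ge2) -exprM mulnC exprM expr2; ring.
have [_ _ oP] := gegenbauerP R n_ge2 (2 * k + eps); rewrite oP ?mul0r //.
rewrite (leq_trans (size_polyMleq _ _)) // size_polyXn addSn /=.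
by have := comp_sqr_size sq; move: (size _) (nat_of_bool _) => a b; lia.
Qed.

(** The expansion in the orthogonal polynomials [H_k] of the discrete measure has
nonnegative coefficients, and [t ^ e * H_k (t ^ 2)] is a Gegenbauer polynomial. *)
Lemma gram_nodal_prefix j : (j <= size B)%N ->
  gram_kernel (fun x y : 'rV[R]_n =>
    dotp x y ^+ eps * (nodal (take j B)).[dotp x y ^+ 2]).
Proof.
move=> jB; set p := nodal _.
have sp : (size p <= size lobatto_nodes)%N.
  by rewrite size_nodal size_rcons size_takel.
have Spos : positive_upto S (size lobatto_nodes).
  apply: discrete_positive; last exact: lobatto_weight_gt0.
  exact: lt_sorted_uniq lobatto_nodes_sorted.
have oH k : (k < size lobatto_nodes)%N -> orth_poly S k (H k).
  by rewrite size_rcons ltnS; apply: orth_half_gegenbauer.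
have pE := orth_poly_expand Spos oH sp.
apply: (@eq_gram_kernel _ _ (fun x y => \sum_(k < size lobatto_nodes)
    (S (p * H k) / S (H k * H k)) * (P (2 * k + eps)).[dotp x y])).
  move=> x y _ _; rewrite [in RHS]pE horner_sum mulr_sumr; apply: eq_bigr => k _.
  rewrite (gegenbauer_half R n_ge2) hornerM hornerXn horner_comp hornerXn hornerZ.
  by rewrite mulrCA.
apply: gram_kernel_sum => k; apply: gram_kernelZ; last exact: gram_gegenbauer.
have Hk := oH k (ltn_ord k).
apply: divr_ge0; last exact/ltW/(orth_poly_sqr_gt0 Spos (ltn_ord k) Hk).
have -> : p = \prod_(b <- take j lobatto_nodes) ('X - b%:P).
  by rewrite /lobatto_nodes -cats1 takel_cat.
apply: nodal_prefix_coef_ge0 Hk; [exact: lobatto_nodes_sorted|exact: lobatto_weight_gt0|].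
by rewrite size_rcons.
Qed.

(** A nonconstant Newton polynomial in [t ^ 2] is the product of two of the kernels of
[gram_nodal_prefix]. *)
Lemma gram_newton i : (i < m)%N ->
  gram_kernel (fun x y : 'rV[R]_n => (nodal (take i (square_nodes A))).[dotp x y ^+ 2]).
Proof.
move=> im; rewrite nodal_take_square_nodes; case: ifP => [_|e0].
  have := gram_kernel_rank1 (n := n) (fun=> 1 : R).
  by apply: eq_gram_kernel => x y _ _; rewrite hornerC mulr1.
apply: (eq_gram_kernel _ (gram_kernelM (@gram_nodal_prefix (i - eps)./2 _)
   (@gram_nodal_prefix (uphalf (i - eps)) _))).
- by move=> x y _ _; rewrite !hornerM hornerXn mulrACA -exprMn -expr2.
- by move: im; rewrite mE; move: (nat_of_bool _) => e; lia.
- by move: im; rewrite mE; move: (nat_of_bool _) => e; lia.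
Qed.

End SharpDesign.

(** * Energies of antipodal codes *)

Section DotProduct.
Variables (R : realType) (n : nat).
Implicit Types x y : 'rV[R]_n.

Lemma dotpC x y : dotp x y = dotp y x.
Proof. by apply: eq_bigr => i _; rewrite mulrC. Qed.

Lemma dotpN x y : dotp x (- y) = - dotp x y.
Proof. by rewrite /dotp -sumrN; apply: eq_bigr => i _; rewrite mxE mulrN. Qed.

Lemma dotp_sqr_le1 x y : dotp x x = 1 -> dotp y y = 1 -> dotp x y ^+ 2 <= 1.
Proof.
move=> x1 y1; have : 0 <= \sum_i (x 0 i - dotp x y * y 0 i) ^+ 2.
  by apply: sumr_ge0 => i _; apply: sqr_ge0.
rewrite (eq_bigr (fun i => x 0 i * x 0 i - 2 * dotp x y * (x 0 i * y 0 i) +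
   dotp x y ^+ 2 * (y 0 i * y 0 i))); last by move=> i _; ring.
rewrite big_split sumrB -!mulr_sumr -!/(dotp _ _) x1 y1 /=; nra.
Qed.

End DotProduct.

Section AntipodalEnergy.
Variables (R : realType) (n N : nat).
Hypothesis N_gt0 : (0 < N)%N.
Variables (x : 'I_(2 * N) -> 'rV[R]_n) (w : 'I_(2 * N) -> R).
Hypothesis x_code : weighted_code x w.
Variable s : 'I_(2 * N) -> 'I_(2 * N).
Hypothesis sP : forall i, x (s i) = - x i.

Lemma partner_neq i : s i != i.
Proof.
have [x1 _ _ _] := x_code; apply/eqP => si.
by have := dotpN (x i) (x i); rewrite -sP si x1; lra.
Qed.

Lemma partnerK : involutive s.
Proof. by move=> i; have [_ xi _ _] := x_code; apply: xi; rewrite !sP opprK. Qed.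

(** The terms of a pair contribute [g 1] times half the sum over all points of the
squared weight of the pair of the point.  The pair weights have mean [1 / N],
so this sum is that of equal weights plus the sum of squared deviations. *)
Lemma antipodal_energy g : energy g x w =
  g 1 * (N%:R^-1 + 2^-1 * \sum_i (w i + w (s i) - N%:R^-1) ^+ 2) +
  \sum_i \sum_(j | (j != i) && (j != s i)) w i * w j * g (dotp (x i) (x j) ^+ 2).
Proof.
have [x1 xinj _ w1] := x_code.
have s_inj : injective s by apply: can_inj partnerK.
have E i : \sum_j w i * w j * g (dotp (x i) (x j) ^+ 2) =
   g 1 * (w i * w i + w i * w (s i)) +
   \sum_(j | (j != i) && (j != s i)) w i * w j * g (dotp (x i) (x j) ^+ 2).
  rewrite (bigD1 i) //= (bigD1 (s i)) ?partner_neq //= addrA; congr (_ + _).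
  by rewrite sP dotpN sqrrN x1 expr1n; ring.
rewrite /energy (eq_bigr _ (fun i _ => E i)) big_split -mulr_sumr /=; congr (_ * _ + _).
have ws1 : \sum_i w (s i) = 1 by rewrite -w1 [RHS](reindex_inj s_inj).
have ws2 : \sum_i w (s i) * w (s i) = \sum_(i < 2 * N) w i * w i.
  by rewrite [RHS](reindex_inj s_inj).
rewrite [X in 2^-1 * X](eq_bigr (fun i => w i * w i + w (s i) * w (s i) + 2 * (w i * w (s i))
   - 2 * N%:R^-1 * w i - 2 * N%:R^-1 * w (s i) + N%:R^-1 ^+ 2)); last first.
  by move=> i _; move: (N%:R^-1) (w i) (w (s i)) => c a b; ring.
rewrite !big_split /= !sumrN -!mulr_sumr ws1 ws2 w1 sumr_const card_ord.
rewrite -[N%:R^-1 *+ _]mulr_natr natrM.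
have N0 : N%:R != 0 :> R by rewrite pnatr_eq0 -lt0n.
by field.
Qed.

End AntipodalEnergy.

(** * The energy bound *)

Lemma energyB (R : realType) (n M : nat) (f g : R -> R)
    (x : 'I_M -> 'rV[R]_n) (w : 'I_M -> R) :
  energy f x w = energy g x w + energy (fun t => f t - g t) x w.
Proof.
rewrite /energy -big_split; apply: eq_bigr => i _; rewrite -big_split.
by apply: eq_bigr => j _ /=; rewrite -mulrDr addrC subrK.
Qed.

Lemma energy_sum (R : realType) (n M k : nat) (c : nat -> R) (g : nat -> {poly R})
    (x : 'I_M -> 'rV[R]_n) (w : 'I_M -> R) :
  energy (horner (\sum_(i < k) c i *: g i)) x w = \sum_(i < k) c i * energy (horner (g i)) x w.
Proof.
rewrite -[LHS]/(energy_functional x w _) linear_sum; apply: eq_bigr => i _.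
exact: functionalZ.
Qed.

Theorem theorem7p4 (R : realType) (n m N : nat)
  (hn : (2 <= n)%N) (hm : (1 <= m)%N) (hN : (1 <= N)%N)
  (A : m.-tuple R)
  (A_incr : sorted <%R A)
  (A_bound : forall a, a \in A -> - 1 < a < 1)
  (A_sym : forall a, a \in A -> - a \in A)
  (xs : 'I_N -> 'rV[R]_n)
  (xs_design : weighted_design m.-1 xs (fun=> N%:R^-1))
  (xs_no_antipodal : no_antipodal_pair xs)
  (xs_dotp : forall i j, i != j -> dotp (xs i) (xs j) \in A)
  (f : R -> R)
  (f_cont : {within `[0, 1], continuous f})
  (f_derivable : derivable_upto m f)
  (f_ge0 : forall k : nat, (1 <= k <= m)%N ->
     forall t : R, 0 < t < 1 -> 0 <= derive1n k f t)
  (x : 'I_(2 * N) -> 'rV[R]_n) (w : 'I_(2 * N) -> R)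
  (x_code : weighted_code x w)
  (x_antipodal : antipodal x) :
  [/\ energy f xs (fun=> N%:R^-1) =
        (N%:R ^+ 2)^-1 *
          \sum_(i < N) \sum_(j < N) f (dotp (xs i) (xs j) ^+ 2),
      energy f xs (fun=> N%:R^-1) <= energy f x w
    & (forall k : nat, (1 <= k <= m)%N ->
         forall t : R, 0 < t < 1 -> 0 < derive1n k f t) ->
      (energy f x w = energy f xs (fun=> N%:R^-1) <->
       [/\ weighted_design m.-1 x w,
           forall i j, x j = - x i -> w i + w j = N%:R^-1
         & forall i j, x j <> x i -> x j <> - x i ->
             dotp (x i) (x j) \in A])].
Proof.
have eq_energy : energy f xs (fun=> N%:R^-1) = (N%:R ^+ 2)^-1 *
    \sum_(i < N) \sum_(j < N) f (dotp (xs i) (xs j) ^+ 2).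
  rewrite mulr_sumr; apply: eq_bigr => i _; rewrite mulr_sumr; apply: eq_bigr => j _.
  by rewrite -exprVn expr2.
have size_A : size A = m := size_tuple A.
pose z := square_nodes A.
have sz : size z = m by rewrite size_square_nodes.
have zn : hermite_nodes z by apply: square_nodes_hermite.
have [h [c [hE hz cP]]] : exists h (c : nat -> R),
    [/\ h = \sum_(i < size z) c i *: nodal (take i z), hermite f z h
    & forall i, (0 < i < size z)%N -> exists2 xi, 0 < xi < 1 &
        derive1n i f xi = c i * i`!%:R].
  by apply: newton_hermite f_cont f_derivable _ _ zn; rewrite sz.
have sh : (size h <= size z)%N by rewrite hE size_newton_sum.
pose d t := f t - h.[t].
have d_node t : t \in z -> d t = 0 by move=> /hz[e _]; rewrite /d e subrr.
have d_rem t : 0 <= t <= 1 -> t \notin z -> exists2 xi, 0 < xi < 1 &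
    d t = derive1n m f xi / m`!%:R * (nodal z).[t].
  have := @hermite_remainder R f m f_cont f_derivable z h t.
  by rewrite sz hm leqnn => rem t01 tz; apply: rem => //; rewrite -sz.
have fact_gt k : 0 < k`!%:R :> R by rewrite ltr0n fact_gt0.
have nodal_ge0 t : 0 <= t -> 0 <= (nodal z).[t] by apply: nodal_square_nodes_ge0.
have d_ge0 t : 0 <= t <= 1 -> 0 <= d t.
  move=> t01; have [/d_node->//|tz] := boolP (t \in z).
  have [xi xi01 ->] := d_rem t t01 tz.
  rewrite mulr_ge0 ?nodal_ge0 ?divr_ge0 ?(ltW (fact_gt _)) //; last by case/andP: t01.
  by apply: f_ge0; rewrite ?hm ?leqnn.
have c_ge0 i : (0 < i < m)%N -> 0 <= c i.
  rewrite -{1}sz => im; have [xi xi01 ci] := cP i im.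
  rewrite -(pmulr_lge0 _ (fact_gt i)) -ci; apply: f_ge0 => //.
  by move: im; rewrite sz => /andP[-> /ltnW].
have [x1 xinj w_ge0 w1] := x_code.
have [[xs1 _ _ _] _] := xs_design.
have sqr01 i j : 0 <= dotp (x i) (x j) ^+ 2 <= 1.
  by rewrite sqr_ge0 dotp_sqr_le1.
have mean_xs (q : {poly R}) : (size q <= m)%N ->
    energy (horner q) xs (fun=> N%:R^-1) = sphere_mean hn q.
  by move=> sq; apply: (design_energy hn xs_design); rewrite prednK.
have d_xs : energy d xs (fun=> N%:R^-1) = d 1 * N%:R^-1.
  rewrite /energy (eq_bigr (fun=> N%:R^-1 * N%:R^-1 * d 1)).
    rewrite sumr_const card_ord -mulr_natr; field.
    by rewrite pnatr_eq0 -lt0n.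
  move=> i _; rewrite (bigD1 i) //= xs1 expr1n big1 ?addr0 // => j ji.
  by rewrite d_node ?mulr0 // sqr_mem_square_nodes // xs_dotp // eq_sym.
have EB M (y : 'I_M -> 'rV[R]_n) v : energy f y v = energy (horner h) y v + energy d y v.
  exact: energyB.
have E_xs : energy f xs (fun=> N%:R^-1) = sphere_mean hn h + d 1 * N%:R^-1.
  by rewrite EB mean_xs -?sz // d_xs.
have [s sP] := choice x_antipodal.
pose rest := \sum_i \sum_(j | (j != i) && (j != s i)) w i * w j * d (dotp (x i) (x j) ^+ 2).
pose dev := \sum_i (w i + w (s i) - N%:R^-1) ^+ 2.
have E_x : energy f x w = energy (horner h) x w + d 1 * N%:R^-1 + d 1 * 2^-1 * dev + rest.
  by rewrite EB (antipodal_energy hN x_code sP d) -/dev -/rest; ring.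
have rest_ge0 : 0 <= rest.
  by do 2 apply: sumr_ge0 => ? _; rewrite mulr_ge0 ?mulr_ge0 // d_ge0.
have dev_ge0 : 0 <= dev by apply: sumr_ge0 => i _; apply: sqr_ge0.
have d1_ge0 : 0 <= d 1 by apply: d_ge0; rewrite ler01 lexx.
pose g i := nodal (take i z).
have sg i : (i < m)%N -> (size (g i) <= m)%N.
  by move=> im; rewrite size_nodal size_takel // sz ltnW.
have g_ge i : (i < m)%N -> sphere_mean hn (g i) <= energy (horner (g i)) x w.
  move=> im; apply: (gram_energy_ge hn xs_design _ _ x_code).
    by rewrite prednK // sg.
  exact: (gram_newton hn hm hN A_incr A_bound A_sym size_A xs_design xs_dotp im).
have g0 : energy (horner (g 0%N)) x w = sphere_mean hn (g 0%N).
  have gE : g 0%N = 1 by rewrite /g take0 /nodal big_nil.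
  rewrite gE /sphere_mean -polyC1 comp_polyC polyC1 divff ?gt_eqF ?sphere_functional1_gt0 //.
  rewrite /energy; under eq_bigr => i _ do under eq_bigr => j _ do rewrite hornerC mulr1.
  by under eq_bigr => i _ do rewrite -mulr_sumr w1 mulr1.
have h_gap : energy (horner h) x w - sphere_mean hn h =
    \sum_(i < m) c i * (energy (horner (g i)) x w - sphere_mean hn (g i)).
  have -> : energy (horner h) x w = \sum_(i < m) c i * energy (horner (g i)) x w.
    by rewrite hE sz; exact: (energy_sum m c g).
  have -> : sphere_mean hn h = \sum_(i < m) c i * sphere_mean hn (g i).
    rewrite hE sz linear_sum; apply: eq_bigr => i _; exact: functionalZ.
  by rewrite -sumrB; apply: eq_bigr => i _; rewrite mulrBr.
have gap_ge0 (i : 'I_m) : 0 <= c i * (energy (horner (g i)) x w - sphere_mean hn (g i)).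
  have [i0|i0] := posnP i; first by rewrite i0 g0 subrr mulr0.
  by rewrite mulr_ge0 ?subr_ge0 ?g_ge // c_ge0 // i0 /=.
have h_ge : sphere_mean hn h <= energy (horner h) x w.
  by rewrite -subr_ge0 h_gap sumr_ge0.
have dev_part_ge0 : 0 <= d 1 * 2^-1 * dev by rewrite !mulr_ge0 // invr_ge0.
split=> //; first by rewrite E_xs E_x; lra.
move=> f_gt0.
have d_gt0 t : 0 <= t <= 1 -> t \notin z -> 0 < d t.
  move=> t01 tz; have [xi xi01 ->] := d_rem t t01 tz.
  rewrite mulr_gt0 ?divr_gt0 //; first by apply: f_gt0; rewrite ?hm ?leqnn.
  rewrite lt_neqAle nodal_ge0 ?andbT; last by case/andP: t01.
  by rewrite eq_sym -/(root _ t) root_nodal.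
have c_gt0 i : (0 < i < m)%N -> 0 < c i.
  rewrite -{1}sz => im; have [xi xi01 ci] := cP i im.
  rewrite -(pmulr_lgt0 _ (fact_gt i)) -ci; apply: f_gt0 => //.
  by move: im; rewrite sz => /andP[-> /ltnW].
have zA t : (t ^+ 2 \in z) = (t \in A) by apply: sqr_mem_square_nodes.
have d1_gt0 : 0 < d 1.
  apply: d_gt0; first by rewrite ler01 lexx.
  by rewrite -[1](expr1n _ 2) zA; apply/negP => /A_bound; rewrite ltxx andbF.
have partnerE i j : x j = - x i -> j = s i by move=> e; apply: xinj; rewrite sP.
have notpair i j : x j <> x i -> x j <> - x i -> (j != i) && (j != s i).
  by move=> ji jsi; apply/andP; split; apply/eqP => e; [apply: ji|apply: jsi]; rewrite e ?sP.
split.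
- move=> eqE.
  have gap0 : energy (horner h) x w - sphere_mean hn h = 0.
    by move: eqE h_ge; rewrite E_xs E_x; lra.
  have dev0 : dev = 0.
    have /eqP : d 1 * 2^-1 * dev = 0 by move: eqE h_ge; rewrite E_xs E_x; lra.
    by rewrite !mulf_eq0 gt_eqF //= invr_eq0 pnatr_eq0 /= => /eqP.
  have rest0 : rest = 0 by move: eqE h_ge; rewrite E_xs E_x; lra.
  have pairw i : w i + w (s i) = N%:R^-1.
    move/eqP: dev0; rewrite psumr_eq0 => [/allP/(_ i)|j _]; last exact: sqr_ge0.
    by rewrite mem_index_enum => /(_ isT) /=; rewrite sqrf_eq0 subr_eq0 => /eqP.
  split.
  + apply: (@energy_design _ _ hn) => // q; rewrite prednK // => sq.
    (* The Newton polynomials span, so equality of energy and mean for each of them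
   is the design property. *)
    apply: (@eq_functional_span _ (energy_functional x w) (sphere_mean hn) g m) => //.
      by move=> i im; rewrite size_nodal size_takel // sz ltnW.
    move=> i im; have [->|i0] := posnP i; first exact: g0.
    move/eqP: gap0; rewrite h_gap psumr_eq0 // => /allP/(_ (Ordinal im)).
    rewrite mem_index_enum => /(_ isT) /=; rewrite mulf_eq0 gt_eqF ?c_gt0 ?i0 //=.
    by rewrite subr_eq0 => /eqP.
  + by move=> i j /partnerE->.
  (* Nonnegative terms with sum zero vanish, but this only bears on points of
   positive weight. *)
  + have rest_term i j : (j != i) && (j != s i) -> 0 < w i -> 0 < w j -> dotp (x i) (x j) \in A.
      move=> ij wi wj; rewrite -zA; apply/contraT => /(d_gt0 _ (sqr01 i j)) dij.
      have term_ge0 a b : 0 <= w a * w b * d (dotp (x a) (x b) ^+ 2).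
        by rewrite !mulr_ge0 // d_ge0.
      have : 0 < rest.
        rewrite /rest (bigD1 i) //= (bigD1 j) //= -addrA ltr_pwDl //.
          by rewrite !mulr_gt0.
        apply: addr_ge0; apply: sumr_ge0 => a _; first exact: term_ge0.
        by apply: sumr_ge0 => b _; exact: term_ge0.
      by rewrite rest0 ltxx.
    (* A pair has total weight [1 / N > 0], so one of its points has positive weight,
   and replacing a point by its antipode only changes the sign of inner products. *)
    have pos_repr i : exists i', (i' = i \/ i' = s i) /\ 0 < w i'.
      have [wi|wi] := ltP 0 (w i); first by exists i; split; [left|].
      exists (s i); split; first by right.
      have : 0 < N%:R^-1 :> R by rewrite invr_gt0 ltr0n.
      by move: (pairw i) wi; lra.
    have sK := partnerK x_code sP.
    move=> i j ji jsi; have /andP[ij ijs] := notpair i j ji jsi.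
    have [i' [ii' wi']] := pos_repr i; have [j' [jj' wj']] := pos_repr j.
    have : dotp (x i') (x j') \in A.
      apply: rest_term => //; case: ii' => ->; case: jj' => ->; rewrite ?sK.
      * by rewrite ij ijs.
      * by rewrite (inj_eq (can_inj sK)) ij andbT (can2_eq sK sK).
      * by rewrite ijs ij.
      * by rewrite (inj_eq (can_inj sK)) ij (can2_eq sK sK) ijs.
    case: ii' => ->; case: jj' => ->; rewrite ?sP ?dotpN ?(dotpC (- _)) ?dotpN ?opprK //.
    * by move=> /A_sym; rewrite opprK.
    * by move=> /A_sym; rewrite opprK dotpC.
    * by rewrite dotpC.
- move=> [x_design pairw dotA].
  have Eh : energy (horner h) x w = sphere_mean hn h.
    by apply: (design_energy hn x_design); rewrite prednK // -sz.
  have dev0 : dev = 0.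
    by rewrite /dev big1 // => i _; rewrite (pairw i (s i) (sP i)) subrr expr0n.
  have rest0 : rest = 0.
    rewrite /rest big1 // => i _; rewrite big1 // => j /andP[ji jsi].
    rewrite d_node ?mulr0 // zA; apply: dotA => [/xinj e|/partnerE e].
      by rewrite e eqxx in ji.
    by rewrite e eqxx in jsi.
  by rewrite E_x E_xs Eh dev0 rest0 mulr0 !addr0.
Qed.
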